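(* Let $p\equiv 1\pmod 3$ be a prime and write $p=x^2+3y^2$ with $x,y\in\mathbb Z$. (i) If $p\equiv x\equiv 1\pmod 4$, then $$\left(\frac 2p\right)2x\equiv\sum_{k=0}^{p-1}(3[3\mid k]-1)(2k+1)\frac{\binom{2k}k^2}{(-16)^k}\pmod{p^2}.$$ (ii) If $-p\equiv y\equiv 1\pmod 4$, then $$\sum_{k=0}^{p-1}\left(\frac k3\right)\frac{\binom{2k}k^2}{(-16)^k}\equiv(-1)^{(p-3)/4}\left(4y-\frac p{3y}\right)\pmod{p^2},$$ and $$\sum_{k=0}^{p-1}\left(\frac k3\right)\frac{k\binom{2k}k^2}{(-16)^k}\equiv(-1)^{(p+1)/4}y\equiv\sum_{k=0}^{p-1}(1-3[3\mid k])\frac{k\binom{2k}k^2}{(-16)^k}\pmod{p^2}.$$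
   Context: $[3\mid k]$ equals $1$ if $3$ divides $k$ and $0$ otherwise. $\left(\frac{\cdot}{p}\right)$ and $\left(\frac{\cdot}{3}\right)$ denote Legendre symbols (so $\left(\frac k3\right)=0,1,-1$ according as $k\equiv0,1,2\pmod 3$). A congruence $a\equiv b\pmod{p^2}$ between rational numbers means $a-b\in p^2\mathbb Z_{(p)}$, where $\mathbb Z_{(p)}$ is the ring of rational numbers with denominator prime to $p$. *)

(* Defs.v *)
From mathcomp Require Import all_boot all_order all_algebra.

Set Implicit Arguments.
Unset Strict Implicit.
Unset Printing Implicit Defensive.

Import Order.TTheory GRing.Theory Num.Theory.

Local Open Scope ring_scope.

(* Meant for p an odd prime. *)
Definition legendre (a : int) (p : nat) : int :=
  if (p%:Z %| a)%Z then 0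
  else if [exists t : 'I_p, ((nat_of_ord t)%:Z ^+ 2 == a %[mod p%:Z])%Z] then 1
  else -1.

(* Z_(p), for p prime; [denq] is the reduced denominator. *)
Definition Zloc (p : nat) : pred rat :=
  fun r => coprimez (denq r) p%:Z.

Definition eqmod_psq (p : nat) (a b : rat) : Prop :=
  exists2 c : rat, c \in Zloc p & a - b = p%:R ^+ 2 * c.

(* Main.v *)
(* Write p = 2n + 1 and let w be a primitive cube root of unity modulo p^2. Modulo
   p^2 the k-th term C(2k,k)^2/(-16)^k is (-1)^k times the coefficient of X^k in the
   Legendre polynomial H(X) = P_n(1 - 2X), so all four sums are combinations of the
   values of H and H' at t = -w and at 1 - t = -w^2.  These points are the fixed
   points of the order-3 symmetry t -> 1/(1 - t) of the Legendre family, i.e. the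
   curves y^2 = x(x - 1)(x - t) with complex multiplication by Z[w].

   The symmetry and a Wronskian computation between P_n(1 - 2X) and
   sum_k C(n,k)^2 X^k, which agree modulo p and satisfy almost the same differential
   equation, give 2 (1 + 2w) H'(t) H(t) = H(t)^2 - p.  Expanding the character sum of
   the curve over Teichmuller representatives, whose coefficients involve harmonic
   numbers, and using the same Wronskian, gives H(t) + p/H(t) = trace of Frobenius.

   The trace is 2A up to sign, where p = A^2 + 3 B^2 is obtained from the second
   moment of the sums of chi(v^3 + c); the signs of A and B come from the product of
   the terms chi(v^3 + c), and A = -(1 + 2w) B modulo p links them.  Hence
   H(t) - p/H(t) is, up to the same sign, 2 (1 + 2w) B modulo p^2. *)
Require Import Defs.
From mathcomp Require Import all_boot all_order all_algebra.
From mathcomp Require Import cyclic finfield ring zify.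

Set Implicit Arguments.
Unset Strict Implicit.
Unset Printing Implicit Defensive.

Import Order.TTheory GRing.Theory Num.Theory.

Local Open Scope ring_scope.

(** * The Legendre polynomial P_n modulo p^2 *)

(** Modulo p it is classical that H(t) is the trace of Frobenius; the obstacle is the next p-adic
    digit. In the character sum, 1 - tau must be raised to the power p n, not n, to be exact modulo
    p^2, which adds p times a truncated logarithm. The harmonic numbers in that correction are those
    measuring [gcoef] - [hcoef], so it can be expressed by values of H' - G' at t and 1/t, with G =
    [gpoly]; this is why one Wronskian serves twice.

    The equation H^2 + p = trace * H alone does not exclude H = 0 modulo p, so the congruence modulo
    p is proved separately to make H a unit. Finally A = -(1 + 2w) B holds only modulo p: the defect
    q = A + (1 + 2w) B satisfies q^2 = 0 and p = 2 A q, and this turns H + p/H into H - p/H. *)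

Section SquareZero.

Variables (R : comUnitRingType) (p n : nat).
Hypothesis p_prime : prime p.
Hypothesis p_odd : p = n.*2.+1.
Hypothesis p_sq0 : p%:R * p%:R = 0 :> R.

Let pE : p%:R = 2 * n%:R + 1 :> R.
Proof. by rewrite p_odd -natr1 -mul2n natrM. Qed.

(** Bezout gives u k = 1 + v p, and 1 - v p inverts 1 + v p because p^2 = 0. *)
Lemma coprime_natr_unit k : coprime k p -> k%:R \is a @GRing.unit R.
Proof.
case: k => [|k]; first by rewrite /coprime gcd0n => /eqP p1; move: p_prime; rewrite p1.
move=> cop; have [u v e _] := @egcdnP k.+1 p isT.
rewrite (eqP cop) in e.
have eR : u%:R * k.+1%:R = v%:R * p%:R + 1 :> R by rewrite -!natrM e natrD.
apply/unitrP; exists (u%:R * (1 - v%:R * p%:R)).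
suff E : k.+1%:R * (u%:R * (1 - v%:R * p%:R)) = 1 :> R by rewrite mulrC E.
have -> : k.+1%:R * (u%:R * (1 - v%:R * p%:R)) =
  u%:R * k.+1%:R * (1 - v%:R * p%:R) :> R by ring.
rewrite eR; have -> : (v%:R * p%:R + 1) * (1 - v%:R * p%:R) = 1 - v%:R ^+ 2 * (p%:R * p%:R) :> R
  by ring.
by rewrite p_sq0; ring.
Qed.

Lemma small_natr_unit k : (0 < k < p)%N -> k%:R \is a @GRing.unit R.
Proof.
case/andP=> k0 kp; apply: coprime_natr_unit.
by rewrite coprime_sym prime_coprime // gtnNdvd.
Qed.

(* [gpoly] is the truncated 2F1(-n, -n; 1; X), and [hpoly] is the Legendre
   polynomial P_n(1 - 2X); they agree modulo p because -n - 1 = n modulo p. *)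
Definition gcoef k : R := 'C(n, k)%:R ^+ 2.
Definition hcoef k : R := (-1) ^+ k * 'C(n, k)%:R * 'C(n + k, k)%:R.
Definition harm k : R := \sum_(i < k) i.+1%:R^-1.

Lemma bin_step k : k.+1%:R * 'C(n, k.+1)%:R = (n%:R - k%:R) * 'C(n, k)%:R :> R.
Proof.
rewrite -natrM mul_bin_left.
case: (leqP k n) => kn; first by rewrite natrM natrB.
by rewrite bin_small // muln0 mulr0.
Qed.

Lemma bin_step2 k :
  k.+1%:R * 'C(n + k.+1, k.+1)%:R = (n%:R + k%:R + 1) * 'C(n + k, k)%:R :> R.
Proof. by rewrite -natrM addnS -mul_bin_diag /= natrM -natrD -natr1. Qed.

Lemma harmS k : harm k.+1 = harm k + k.+1%:R^-1.
Proof. by rewrite /harm big_ord_recr. Qed.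

(** Since n + j + 1 = p - (n - j), the left side is C(n, k) with each factor n - j replaced by n - j
    - p; the first-order term in p is a partial harmonic sum. *)
Lemma hbin_harm k : (k <= n)%N ->
  (-1) ^+ k * 'C(n + k, k)%:R = 'C(n, k)%:R * (1 - p%:R * (harm n - harm (n - k))).
Proof.
elim: k => [|k IH] kn; first by rewrite !bin0 subn0 expr0; ring.
have {}IH := IH (ltnW kn).
have u1 : k.+1%:R \is a @GRing.unit R by apply: small_natr_unit; lia.
have u2 : (n - k)%:R \is a @GRing.unit R by apply: small_natr_unit; lia.
apply: (mulrI u1).
have -> : k.+1%:R * ((-1) ^+ k.+1 * 'C(n + k.+1, k.+1)%:R) =
   - (-1) ^+ k * (k.+1%:R * 'C(n + k.+1, k.+1)%:R) :> R by rewrite exprS; ring.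
rewrite bin_step2 [in RHS]mulrA bin_step.
have -> : - (-1) ^+ k * ((n%:R + k%:R + 1) * 'C(n + k, k)%:R) =
   - (n%:R + k%:R + 1) * ((-1) ^+ k * 'C(n + k, k)%:R) :> R by ring.
rewrite IH.
have -> : (n - k = (n - k.+1).+1)%N by lia.
rewrite harmS; have <- : (n - k = (n - k.+1).+1)%N by lia.
set a := (n - k)%:R; have aE : a = n%:R - k%:R :> R by rewrite /a natrB // ltnW.
have -> : n%:R + k%:R + 1 = p%:R - a :> R by rewrite aE pE; ring.
rewrite -aE; set x := harm _; set y := harm _; set c := 'C(n, k)%:R.
have av : a * a^-1 = 1 by rewrite divrr.
have -> : - (p%:R - a) * (c * (1 - p%:R * (x - (y + a^-1)))) =
  c * (a - p%:R) + c * (- a * p%:R * (x - y) + p%:R * (a * a^-1)) +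
   c * (p%:R * p%:R * (x - y - a^-1)) by ring.
by rewrite p_sq0 av; ring.
Qed.

Lemma gcoef_sub_hcoef k : (k <= n)%N ->
  gcoef k - hcoef k = p%:R * (gcoef k * (harm n - harm (n - k))).
Proof.
move=> kn; have := hbin_harm kn; rewrite /gcoef /hcoef => e.
by rewrite -mulrA mulrCA e; ring.
Qed.

Lemma p_gcoef k : p%:R * gcoef k = p%:R * hcoef k.
Proof.
case: (leqP k n) => kn; last by rewrite /gcoef /hcoef bin_small //; ring.
apply/eqP; rewrite -subr_eq0 -mulrBr gcoef_sub_hcoef //.
by rewrite (mulrA p%:R p%:R) p_sq0 mul0r.
Qed.

Definition gpoly : {poly R} := \poly_(k < n.+1) gcoef k.
Definition hpoly : {poly R} := \poly_(k < n.+1) hcoef k.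

Lemma coef_gpoly k : gpoly`_k = gcoef k.
Proof. by rewrite coef_poly /gcoef; case: ltnP => // kn; rewrite bin_small ?expr0n. Qed.
Lemma coef_hpoly k : hpoly`_k = hcoef k.
Proof. by rewrite coef_poly /hcoef; case: ltnP => // kn; rewrite bin_small // mulr0 mul0r. Qed.

Lemma coefXD (q : {poly R}) k : ('X * q^`())`_k = k%:R * q`_k.
Proof. by rewrite coefXM; case: k => [|k] /=; rewrite ?mul0r // coef_deriv mulr_natl. Qed.

(* The hypergeometric (Picard-Fuchs) operator of the Legendre family: [hpoly] and
   [gpoly] are solutions modulo p, with explicit error terms modulo p^2. *)
Definition pf_op (q : {poly R}) : {poly R} :=
  'X * (1 - 'X) * q^`(2) + (1 - 2 * 'X) * q^`() - (n%:R ^+ 2)%:P * q.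

Lemma coef_pf_op q k : (pf_op q)`_k =
  k.+1%:R ^+ 2 * q`_k.+1 - (k%:R ^+ 2 + k%:R + n%:R ^+ 2) * q`_k.
Proof.
have -> : pf_op q = 'X * q^`()^`() - 'X * ('X * q^`()^`()) + q^`() - 2%:R%:P * ('X * q^`())
   - (n%:R ^+ 2)%:P * q.
  by rewrite /pf_op derivSn derivn1 polyC_natr; ring.
rewrite !(coefD, coefN) !coefCM (coefXM ('X * _)) !coefXD coef_deriv -mulr_natl.
have -> : (if k == 0 then 0 else k.-1%:R * (q^`())`_k.-1) = (k%:R ^+ 2 - k%:R) * q`_k.
  case: k => [|k] /=; first by ring.
  by rewrite coef_deriv -mulr_natl -natr1; ring.
by rewrite -(natr1 k); ring.
Qed.

(** Coefficientwise, (n - k)^2 - k^2 - k - n^2 = -(2n + 1) k = -p k. *)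
Lemma pf_op_gpoly : pf_op gpoly = - p%:R%:P * ('X * gpoly^`()).
Proof.
apply/polyP=> k; rewrite coef_pf_op mulNr coefN coefCM coefXD !coef_gpoly /gcoef.
have -> : k.+1%:R ^+ 2 * 'C(n, k.+1)%:R ^+ 2 = (k.+1%:R * 'C(n, k.+1)%:R) ^+ 2 :> R by ring.
by rewrite bin_step pE; ring.
Qed.

(** Coefficientwise, -(n - k)(n + k + 1) - k^2 - k - n^2 = -n (2n + 1) = -n p. *)
Lemma pf_op_hpoly : pf_op hpoly = - (n%:R * p%:R)%:P * hpoly.
Proof.
apply/polyP=> k; rewrite coef_pf_op mulNr coefN coefCM !coef_hpoly /hcoef.
have -> : k.+1%:R ^+ 2 * ((-1) ^+ k.+1 * 'C(n, k.+1)%:R * 'C(n + k.+1, k.+1)%:R) =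
 - (-1) ^+ k * (k.+1%:R * 'C(n, k.+1)%:R) * (k.+1%:R * 'C(n + k.+1, k.+1)%:R) :> R
  by rewrite (exprS (-1)); ring.
by rewrite bin_step bin_step2 pE; ring.
Qed.

Lemma p_gpoly : p%:R%:P * gpoly = p%:R%:P * hpoly.
Proof. by apply/polyP=> k; rewrite !coefCM coef_gpoly coef_hpoly p_gcoef. Qed.

Definition wronskian : {poly R} := gpoly * hpoly^`() - hpoly * gpoly^`().

(** For two exact solutions, X (1 - X) times the Wronskian would be constant (Abel). Modulo p^2 the
    two error terms add up to the derivative of p X G^2, which is subtracted here. *)
Definition wpoly : {poly R} :=
  2 * 'X * (1 - 'X) * wronskian - p%:R%:P * 'X * gpoly ^+ 2.

Lemma deriv_wpoly : wpoly^`() = 0.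
Proof.
have pp : p%:R%:P * p%:R%:P = 0 :> {poly R} by rewrite -polyCM p_sq0.
have pEP : p%:R%:P = 2 * n%:R%:P + 1 :> {poly R} by rewrite pE polyCD polyCM !polyC_natr.
have -> : wpoly^`() = 2 * (gpoly * pf_op hpoly - hpoly * pf_op gpoly)
   - p%:R%:P * gpoly ^+ 2 - 2 * 'X * gpoly^`() * (p%:R%:P * gpoly).
  rewrite /wpoly /wronskian /pf_op !(derivB, derivM, derivC, derivX, derivE).
  by rewrite !derivSn !derivn0; ring.
rewrite pf_op_gpoly pf_op_hpoly p_gpoly polyCM.
have -> : 2 * (gpoly * (- (n%:R%:P * p%:R%:P) * hpoly) -
    hpoly * (- p%:R%:P * ('X * gpoly^`()))) -
  p%:R%:P * gpoly ^+ 2 - 2 * 'X * gpoly^`() * (p%:R%:P * hpoly) =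
  - (2 * n%:R%:P) * gpoly * (p%:R%:P * hpoly) - gpoly * (p%:R%:P * gpoly)  by ring.
rewrite -p_gpoly; have -> : 2 * n%:R%:P = p%:R%:P - 1 :> {poly R} by rewrite pEP; ring.
have -> : - (p%:R%:P - 1) * gpoly * (p%:R%:P * gpoly) - gpoly * (p%:R%:P * gpoly) =
   - gpoly ^+ 2 * (p%:R%:P * p%:R%:P) by ring.
by rewrite pp mulr0.
Qed.

Lemma size_gpoly : (size gpoly <= n.+1)%N. Proof. exact: size_poly. Qed.
Lemma size_hpoly : (size hpoly <= n.+1)%N. Proof. exact: size_poly. Qed.



Lemma coefM_top (q r : {poly R}) a b :
  (size q <= a.+1)%N -> (size r <= b.+1)%N -> (q * r)`_(a + b) = q`_a * r`_b.
Proof.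
move=> sq sr; rewrite coefM (bigD1 (inord a)) //= inordK ?ltnS ?leq_addr //.
rewrite addKn big1 ?addr0 // => i; rewrite -val_eqE /= inordK ?ltnS ?leq_addr // => ia.
case: (ltngtP i a) ia => // lia _.
  by rewrite [X in _ * X]nth_default ?mulr0 //; apply: leq_trans sr _; lia.
by rewrite nth_default ?mul0r //; apply: leq_trans sq _.
Qed.

Lemma n_gt0 : (0 < n)%N.
Proof. by have := prime_gt1 p_prime; rewrite p_odd; case: (n). Qed.

(* The derivative of [wpoly] vanishes, so only the exponents 0 and p survive. *)
Lemma wpolyE : wpoly = - p%:R%:P * 'X^p.
Proof.
have n0 := n_gt0.
have sG' : (size gpoly^`() <= n.-1.+1)%N.
  apply/leq_sizeP => j jn; rewrite coef_deriv nth_default ?mul0rn //.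
  by apply: leq_trans size_gpoly _; lia.
have sH' : (size hpoly^`() <= n.-1.+1)%N.
  apply/leq_sizeP => j jn; rewrite coef_deriv nth_default ?mul0rn //.
  by apply: leq_trans size_hpoly _; lia.
have sM (q r : {poly R}) : (size q <= n.+1 -> size r <= n.-1.+1 -> size (q * r)%R <= n.*2)%N.
  by move=> sq sr; apply: leq_trans (size_polyMleq _ _) _; lia.
have sW : (size wronskian <= n.*2)%N.
  rewrite /wronskian (leq_trans (size_polyD _ _)) // size_polyN geq_max.
  by rewrite !sM ?size_gpoly ?size_hpoly.
have wE : wpoly = 2%:R%:P * ('X * wronskian) - 2%:R%:P * ('X * ('X * wronskian))
    - p%:R%:P * ('X * gpoly ^+ 2).
  by rewrite /wpoly polyC_natr; ring.
have sGG : (size (gpoly ^+ 2) <= n.*2.+1)%N.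
  rewrite expr2 (leq_trans (size_polyMleq _ _)) //; have := size_gpoly; lia.
apply/polyP => k; rewrite mulNr coefN coefCM coefXn.
case: (ltngtP k p) => kp; rewrite ?mulr0 ?mulr1 ?oppr0.
- case: k kp => [|k] kp; first by rewrite wE !(coefD, coefN, coefCM, coefXM) /=; ring.
  have u : k.+1%:R \is a @GRing.unit R by apply: small_natr_unit; lia.
  apply: (mulrI u); have := deriv_wpoly => /polyP /(_ k).
  by rewrite coef_deriv coef0 mulr0 mulr_natl.
- have W0 j : (n.*2 <= j)%N -> wronskian`_j = 0.
    by move=> nj; rewrite nth_default //; apply: leq_trans sW _.
  have GG0 j : (n.*2 < j)%N -> (gpoly ^+ 2)`_j = 0.
    by move=> nj; rewrite nth_default //; apply: leq_trans sGG _.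
  rewrite wE; move: wronskian (gpoly ^+ 2) W0 GG0 => W Q W0 Q0.
  rewrite !(coefD, coefN, coefCM, coefXM); case: k kp => [|[|k]] kp; [lia|lia|].
  by rewrite /= !W0 ?Q0; try lia; ring.
have W1 : wronskian`_n.*2 = 0 by rewrite nth_default.
have Q1 : (gpoly ^+ 2)`_n.*2 = 1.
  by rewrite expr2 -addnn coefM_top ?size_gpoly // coef_gpoly /gcoef binn expr1n mulr1.
(* Both products have the same leading coefficient, so the coefficient of X^p comes from p X G^2
   alone. *)
have W2 : wronskian`_n.*2.-1 = 0.
  have -> : (n.*2.-1 = n + n.-1)%N by lia.
  rewrite /wronskian coefB !coefM_top ?size_gpoly ?size_hpoly //.
  by rewrite !coef_deriv prednK // !coef_gpoly !coef_hpoly; ring.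
rewrite kp wE; move: wronskian (gpoly ^+ 2) W1 Q1 W2 => W Q W1 Q1 W2.
rewrite !(coefD, coefN, coefCM, coefXM) p_odd /= W1 Q1 W2.
by have -> : (n.*2 == 0)%N = false; [lia | ring].
Qed.

(** C(n, k) C(k, j) = C(n, j) C(n - j, n - k): choose the j elements first, then those left out of
    the k-set. What remains is a Vandermonde convolution. *)
Lemma sum_bin_sq_bin j : (j <= n)%N ->
  (\sum_(k < n.+1) 'C(n, k) ^ 2 * 'C(k, j) = 'C(n, j) * 'C(n + (n - j), n))%N.
Proof.
move=> jn; rewrite -binomial.Vandermonde big_distrr /=; apply: eq_bigr => k _.
have kn : (k <= n)%N by rewrite -ltnS.
case: (ltnP k j) => kj.
  by rewrite !(@bin_small k j) ?(@bin_small (n - j)) ?muln0 //; lia.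
suff e : ('C(n, k) * 'C(k, j) = 'C(n, j) * 'C(n - j, n - k))%N.
  by rewrite expnS expn1 -mulnA e mulnCA.
have -> : 'C(n - j, n - k) = 'C(n - j, k - j).
  by rewrite -[RHS]bin_sub ?leq_sub2r //; congr 'C(_, _); lia.
apply/eqP; rewrite -(eqn_pmul2r (fact_gt0 j)) -(eqn_pmul2r (fact_gt0 (k - j))).
rewrite -(eqn_pmul2r (fact_gt0 (n - k))).
have e1 := bin_fact kn; have e2 := bin_fact kj; have e3 := bin_fact jn.
have e4 : ('C(n - j, k - j) * ((k - j)`! * (n - k)`!) = (n - j)`!)%N.
  by rewrite -(@bin_fact (n - j) (k - j)) ?leq_sub2r // subnBA // subnK.
apply/eqP; transitivity n`!; [rewrite -e1 -e2 | rewrite -e3 -e4]; lia.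
Qed.

Lemma coef_one_sub_exp (c : R) k j :
  ((1 - c%:P * 'X) ^+ k)`_j = (- c) ^+ j * 'C(k, j)%:R.
Proof.
have -> : (1 - c%:P * 'X) ^+ k = \poly_(i < k.+1) ((- c) ^+ i * 'C(k, i)%:R) :> {poly R}.
  rewrite exprBn poly_def; apply: eq_bigr => i _.
  rewrite expr1n mulr1 exprMn -mul_polyC polyCM !polyC_exp polyCN polyC_natr [in RHS]exprNn.
  by ring.
by rewrite coef_poly; case: ltnP => // kj; rewrite bin_small ?mulr0.
Qed.

(** That is, G(1 - X) = (-1)^n X^n H(1/X): the order-3 symmetry, as an exact identity carrying G to
    H. *)
Lemma gpoly_comp :
  gpoly \Po (1 - 'X) = \poly_(j < n.+1) ((-1) ^+ n * hcoef (n - j)).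
Proof.
apply/polyP=> j; rewrite comp_polyE coef_sum coef_poly.
have sG k : (k < size gpoly)%N -> (k < n.+1)%N by move=> h; apply: leq_trans h size_gpoly.
rewrite (big_ord_widen_cond n.+1 xpredT (fun k => (gpoly`_k *: (1 - 'X) ^+ k)`_j)) ?size_gpoly //.
rewrite big_mkcondr /=.
have cE k : ((1 - 'X) ^+ k)`_j = (-1) ^+ j * 'C(k, j)%:R :> R.
  by rewrite -coef_one_sub_exp mul1r.
have -> : \sum_(i < n.+1) (if (i < size gpoly)%N then (gpoly`_i *: (1 - 'X) ^+ i)`_j else 0) =
  (-1) ^+ j * (\sum_(i < n.+1) 'C(n, i) ^ 2 * 'C(i, j))%N%:R.
  rewrite natr_sum big_distrr /=; apply: eq_bigr => i _.
  rewrite coefZ cE; case: ltnP => [_|si]; rewrite natrM natrX -/(gcoef i) -coef_gpoly; first by ring.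
  by rewrite [gpoly`_i]nth_default // mul0r mulr0.
case: ltnP => [jn|nj]; last first.
  rewrite big1 ?mulr0 // => i _; rewrite [X in (_ * X)%N]bin_small ?muln0 //.
  by rewrite (leq_trans _ nj).
rewrite sum_bin_sq_bin // /hcoef bin_sub // natrM.
have -> : 'C(n + (n - j), n - j) = 'C(n + (n - j), n).
  by rewrite -[RHS]bin_sub ?leq_addr // addKn.
have -> : (-1) ^+ n = (-1) ^+ (n - j) * (-1) ^+ j :> R by rewrite -exprD subnK.
have : (-1) ^+ (n - j) * (-1) ^+ (n - j) = 1 :> R by rewrite -expr2 sqrr_sign.
move: ((-1) ^+ (n - j)) => e ee.
by transitivity (e * e * ((-1) ^+ j * ('C(n, j)%:R * 'C(n + (n - j), n)%:R))); [rewrite ee mul1r | ring].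
Qed.

Lemma sum_rev (c : nat -> R) (t u : R) : t * u = 1 ->
  \sum_(j < n.+1) c (n - j)%N * u ^+ j = u ^+ n * \sum_(j < n.+1) c j * t ^+ j.
Proof.
move=> tu; rewrite (reindex_inj rev_ord_inj) big_distrr /=; apply: eq_bigr => j _.
have jn : (j <= n)%N by rewrite -ltnS.
rewrite subSS subKn // mulrCA; congr (_ * _).
have -> : u ^+ n = u ^+ (n - j) * u ^+ j by rewrite -exprD subnK.
rewrite -mulrA -exprMn [u * t]mulrC tu expr1n mulr1 //.
Qed.

Lemma horner_wide (q : {poly R}) t : (size q <= n.+1)%N ->
  q.[t] = \sum_(j < n.+1) q`_j * t ^+ j.
Proof. exact: horner_coef_wide. Qed.

Lemma horner_XD (q : {poly R}) t : (size q <= n.+1)%N ->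
  t * q^`().[t] = \sum_(j < n.+1) j%:R * q`_j * t ^+ j.
Proof.
move=> sq; have -> : t * q^`().[t] = ('X * q^`()).[t] by rewrite hornerM hornerX.
rewrite horner_wide; first by apply: eq_bigr => j _; rewrite coefXD.
by apply/leq_sizeP => j nj; rewrite coefXD nth_default ?mulr0 //; apply: leq_trans nj.
Qed.

(** * Values and derivatives at the fixed points of the order-3 symmetry *)

Section SixthRoot.

Variables (m : nat) (t : R).
Hypothesis n_3m : n = (3 * m)%N.
Hypothesis t_sq : t ^+ 2 = t - 1.

Lemma sixth_root_inv : t * (1 - t) = 1.
Proof. by rewrite mulrBr mulr1 -expr2 t_sq; ring. Qed.

Lemma sixth_root_cube : t ^+ 3 = -1.
Proof. by rewrite exprS t_sq mulrBr mulr1 -expr2 t_sq; ring. Qed.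

Lemma sixth_root_expn : t ^+ n = (-1) ^+ n.
Proof. by rewrite n_3m !exprM sixth_root_cube; congr (_ ^+ _); ring. Qed.

End SixthRoot.

Section SixthRootValues.

Variables (m : nat) (t : R).
Hypothesis n_3m : n = (3 * m)%N.
Hypothesis t_sq : t ^+ 2 = t - 1.

Let u := 1 - t.
Let u_sq : u ^+ 2 = u - 1.
Proof. by rewrite /u sqrrB t_sq; ring. Qed.
Let tu : t * u = 1. Proof. exact: sixth_root_inv. Qed.
Let un : u ^+ n = (-1) ^+ n. Proof. exact: sixth_root_expn n_3m u_sq. Qed.
Let sgn2 : (-1) ^+ n * (-1) ^+ n = 1 :> R. Proof. by rewrite -expr2 sqrr_sign. Qed.

(** As u = 1 - t = 1/t, [gpoly_comp] at u reads G(t) = (-1)^n u^n H(t), and u^n = (-1)^n because u^3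
    = -1 and 3 divides n. *)
Lemma gpoly_fix : gpoly.[t] = hpoly.[t].
Proof.
have tE : t = (1 - 'X).[u] by rewrite !hornerE /u; ring.
rewrite [in LHS]tE -horner_comp gpoly_comp (horner_wide _ (size_poly _ _)).
under eq_bigr => j _ do rewrite coef_poly ltn_ord -mulrA.
rewrite -big_distrr /= (sum_rev _ tu) mulrA un sgn2 mul1r.
by rewrite horner_wide ?size_hpoly //; apply: eq_bigr => j _; rewrite coef_hpoly.
Qed.

Lemma deriv_gpoly_fix :
  gpoly^`().[t] = t ^+ 2 * hpoly^`().[t] - n%:R * t * hpoly.[t].
Proof.
have tE : t = (1 - 'X).[u] by rewrite !hornerE /u; ring.
have : (gpoly \Po (1 - 'X))^`().[u] = - gpoly^`().[t].
  rewrite deriv_comp hornerM horner_comp -tE derivB derivC derivX.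
  by rewrite !hornerE; ring.
rewrite gpoly_comp; set q := \poly_(j < _) _ => eq.
have : u * q^`().[u] = n%:R * hpoly.[t] - t * hpoly^`().[t].
  rewrite horner_XD ?size_poly //.
  transitivity (u ^+ n * \sum_(j < n.+1)
      ((-1) ^+ n * ((n%:R - j%:R) * hcoef j)) * t ^+ j).
    rewrite -(sum_rev (fun k => (-1) ^+ n * ((n%:R - k%:R) * hcoef k)) tu).
    apply: eq_bigr => j _; rewrite coef_poly ltn_ord natrB; first by ring.
    by rewrite -ltnS.
  rewrite un (horner_wide _ size_hpoly) (horner_XD _ size_hpoly).
  rewrite !big_distrr /= -sumrB; apply: eq_bigr => j _; rewrite coef_hpoly.
  transitivity ((-1) ^+ n * (-1) ^+ n * ((n%:R - j%:R) * hcoef j * t ^+ j)); first by ring.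
  by rewrite sgn2; ring.
rewrite eq => e; have {}e : t * u * gpoly^`().[t] = t * (t * hpoly^`().[t] - n%:R * hpoly.[t]).
  by rewrite -[t * u * _]mulrA; congr (_ * _); rewrite -[LHS]opprK -mulrN e; ring.
by rewrite tu mul1r in e; rewrite e; ring.
Qed.

(** The coefficients C(n, k)^2 are palindromic and u = 1/t. *)
Lemma gpoly_inv : gpoly.[u] = (-1) ^+ n * gpoly.[t].
Proof.
rewrite !(horner_wide _ size_gpoly) -un -(sum_rev (fun j => gpoly`_j) tu).
apply: eq_bigr => j _; rewrite !coef_gpoly /gcoef bin_sub // -ltnS //.
Qed.

Lemma deriv_gpoly_inv :
  u * gpoly^`().[u] = (-1) ^+ n * (n%:R * gpoly.[t] - t * gpoly^`().[t]).
Proof.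
rewrite !(horner_XD _ size_gpoly) (horner_wide _ size_gpoly) big_distrr -sumrB /= -un.
transitivity (u ^+ n * \sum_(j < n.+1) ((n%:R - j%:R) * gcoef j) * t ^+ j).
  rewrite -(sum_rev (fun j => (n%:R - j%:R) * gcoef j) tu).
  apply: eq_bigr => j _; have jn : (j <= n)%N by rewrite -ltnS.
  by rewrite natrB // coef_gpoly /gcoef bin_sub //; ring.
by congr (_ * _); apply: eq_bigr => j _; rewrite coef_gpoly; ring.
Qed.

End SixthRootValues.

Section SixthRootDerivatives.

Variables (m : nat) (t : R).
Hypothesis n_3m : n = (3 * m)%N.
Hypothesis t_sq : t ^+ 2 = t - 1.

Let u := 1 - t.
Let u_sq : u ^+ 2 = u - 1.
Proof. by rewrite /u sqrrB t_sq; ring. Qed.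
Let tu : t * u = 1. Proof. exact: sixth_root_inv. Qed.
Let sgn2 : (-1) ^+ n * (-1) ^+ n = 1 :> R. Proof. by rewrite -expr2 sqrr_sign. Qed.

Lemma sixth_root_expp : t ^+ p = t.
Proof. by rewrite p_odd exprS -muln2 exprM (sixth_root_expn n_3m t_sq) sqrr_sign mulr1. Qed.

Lemma hpoly_inv : hpoly.[u] = (-1) ^+ n * hpoly.[t].
Proof. by rewrite -(gpoly_fix n_3m u_sq) (gpoly_inv n_3m t_sq) (gpoly_fix n_3m t_sq). Qed.

(** Derivative form of the parity P_n(-x) = (-1)^n P_n(x), obtained here from the palindromy of
    [gpoly] through [deriv_gpoly_fix] at both fixed points. *)
Lemma deriv_hpoly_inv : hpoly^`().[u] = - (-1) ^+ n * hpoly^`().[t].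
Proof.
have := deriv_gpoly_inv n_3m t_sq; rewrite (deriv_gpoly_fix n_3m t_sq).
rewrite (deriv_gpoly_fix n_3m u_sq) (gpoly_fix n_3m t_sq) hpoly_inv.
set e := (-1) ^+ n; set H := hpoly.[t]; set D := _.[t]; set E := _.[u].
have -> : u * (u ^+ 2 * E - n%:R * u * (e * H)) = u ^+ 3 * E - n%:R * u ^+ 2 * e * H by ring.
have -> : n%:R * H - t * (t ^+ 2 * D - n%:R * t * H) = n%:R * H - t ^+ 3 * D + n%:R * t ^+ 2 * H
  by ring.
rewrite (sixth_root_cube u_sq) (sixth_root_cube t_sq) u_sq t_sq /u => eq.
have -> : E = - (-1 * E - n%:R * (1 - t - 1) * e * H) + n%:R * t * e * H by ring.
by rewrite eq; ring.
Qed.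

(** Evaluate [wpolyE] at t, where t (1 - t) = 1 and t^p = t, and eliminate G and G'. *)
Lemma deriv_hpoly_fix :
  2 * (1 - 2 * t) * hpoly^`().[t] * hpoly.[t] = hpoly.[t] ^+ 2 - p%:R.
Proof.
have /(congr1 (fun q => q.[t])) := wpolyE.
rewrite /wpoly /wronskian -polyC_natr.
rewrite !(hornerD, hornerN, hornerM, hornerC, hornerX, horner_exp, hornerXn) sixth_root_expp.
rewrite (deriv_gpoly_fix n_3m t_sq) (gpoly_fix n_3m t_sq).
set H := hpoly.[t]; set D := _.[t]; rewrite -/u.
have -> : 2 * t * u = 2 by rewrite -mulrA tu mulr1.
have -> : H * D - H * (t ^+ 2 * D - n%:R * t * H) = (1 - t ^+ 2) * D * H + n%:R * t * H ^+ 2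
  by ring.
rewrite t_sq => eq; have /(congr1 (fun z => u * z)) := eq.
have -> : u * (2 * ((1 - (t - 1)) * D * H + n%:R * t * H ^+ 2) - p%:R * t * H ^+ 2) =
  2 * ((2 * u - t * u) * D * H + n%:R * (t * u) * H ^+ 2) - p%:R * (t * u) * H ^+ 2 by ring.
have -> : u * (- p%:R * t) = - p%:R * (t * u) by ring.
rewrite tu pE /u => eq2.
have -> : 2 * (1 - 2 * t) * D * H = 2 * ((2 * (1 - t) - 1) * D * H + n%:R * 1 * H ^+ 2) -
   (2 * n%:R + 1) * 1 * H ^+ 2 + H ^+ 2 by ring.
by rewrite eq2; ring.
Qed.

(** Relative to (-1)^s C(n, s), the p-part of the coefficient of x^s in (1 - x)^(p n), exponents
    being reduced modulo p - 1; see [p_log_poly]. *)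
Definition logcoef s : R :=
  1 + n%:R * harm n - s%:R * harm s - (n - s)%:R * harm (n - s).

Lemma gcoef_rev s : (s <= n)%N -> gcoef (n - s) = gcoef s.
Proof. by move=> sn; rewrite /gcoef bin_sub. Qed.

(** The harmonic part splits as s (h_n - h_s) + (n - s) (h_n - h_(n-s)), with h = [harm]; by
    [gcoef_sub_hcoef] each difference measures [gcoef] - [hcoef]. *)
Lemma p_logcoef s : (s <= n)%N ->
  p%:R * (gcoef s * logcoef s) = p%:R * gcoef s +
    (s%:R * (gcoef (n - s) - hcoef (n - s)) + (n - s)%:R * (gcoef s - hcoef s)).
Proof.
move=> sn; rewrite (gcoef_sub_hcoef sn) (gcoef_sub_hcoef (leq_subr s n)) gcoef_rev // subKn //.
by rewrite /logcoef natrB //; ring.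
Qed.

(** By [p_logcoef] the sum is p H plus combinations of H' - G' at t and at 1/t; the fixed-point
    relations reduce these to H and H' at t, and [deriv_hpoly_fix] removes H'. *)
Lemma logcoef_sum :
  2 * hpoly.[t] * (p%:R * \sum_(s < n.+1) gcoef s * logcoef s * t ^+ s) =
  p%:R * hpoly.[t] ^+ 2 + p%:R.
Proof.
pose d j := gcoef j - hcoef j.
have dE v : v ^+ 2 = v - 1 ->
  \sum_(s < n.+1) (n - s)%:R * d s * v ^+ s = v * (hpoly^`().[v] - gpoly^`().[v]).
  move=> v_sq; rewrite mulrBr (horner_XD _ size_hpoly) (horner_XD _ size_gpoly).
  rewrite -[RHS]addr0 -[X in _ + X](subrr (n%:R * gpoly.[v])).
  rewrite [X in _ - _ * X](gpoly_fix n_3m v_sq).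
  rewrite (horner_wide _ size_gpoly) (horner_wide _ size_hpoly) !big_distrr /=.
  rewrite -!sumrB -big_split /=; apply: eq_bigr => j _; rewrite natrB; last by rewrite -ltnS.
  by rewrite coef_gpoly coef_hpoly /d; ring.
have -> : p%:R * (\sum_(s < n.+1) gcoef s * logcoef s * t ^+ s) =
   p%:R * hpoly.[t] + (\sum_(s < n.+1) (s%:R * d (n - s)%N) * t ^+ s
   + \sum_(s < n.+1) (n - s)%:R * d s * t ^+ s).
  rewrite -(gpoly_fix n_3m t_sq) (horner_wide _ size_gpoly) !big_distrr /= -!big_split /=.
  apply: eq_bigr => j _; rewrite mulrA p_logcoef; last by rewrite -ltnS.
  by rewrite coef_gpoly /d; ring.
have -> : \sum_(s < n.+1) (s%:R * d (n - s)%N) * t ^+ s =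
  (-1) ^+ n * (u * (hpoly^`().[u] - gpoly^`().[u])).
  rewrite -(dE _ u_sq) -(sixth_root_expn n_3m t_sq).
  rewrite -(@sum_rev (fun j => (n - j)%:R * d j) u t); last by rewrite mulrC.
  by apply: eq_bigr => j _; rewrite subKn // -ltnS.
rewrite (dE _ t_sq) (mulrBr u) (deriv_gpoly_inv n_3m t_sq) deriv_hpoly_inv (gpoly_fix n_3m t_sq).
have := deriv_hpoly_fix; set H := hpoly.[t]; set D := _.[t]; set E := _.[t] => eq.
set e := (-1) ^+ n.
transitivity (2 * p%:R * H ^+ 2 + 2 * H * ((e * e) * (- u * D - n%:R * H + t * E) + t * (D - E)));
  first by ring.
rewrite sgn2; transitivity (2 * p%:R * H ^+ 2 - 2 * n%:R * H ^+ 2 - 2 * (1 - 2 * t) * D * H);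
  first by rewrite /u; ring.
by rewrite eq pE; ring.
Qed.

End SixthRootDerivatives.

(** * Closed form of alternating binomial sums of reciprocals *)

Section AlternatingLog.

(* [shifted_inv s m] is 1/(s - m), with 1/(s - m) replaced by 1/(s - 1 - m) when
   m >= s: reducing exponents modulo p - 1 shifts the denominators by one. *)
Definition shifted_inv (s m : nat) : R :=
  if (m < s)%N then (s - m)%:R^-1 else - (m.+1 - s)%:R^-1.

Definition altlog r s : R := - \sum_(m < r.+1) (-1) ^+ m * 'C(r, m)%:R * shifted_inv s m.

Lemma alt_bin_sum r : \sum_(m < r.+2) (-1) ^+ m * 'C(r.+1, m)%:R = 0 :> R.
Proof.
have := exprBn (1 : R) 1 r.+1; rewrite subrr expr0n /= => e; rewrite [RHS]e.
by apply: eq_bigr => i _; rewrite !expr1n !mulr1 mulr_natr.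
Qed.

Lemma alt_bin_pascal r (f : nat -> R) :
  \sum_(m < r.+2) (-1) ^+ m * 'C(r.+1, m)%:R * f m =
  \sum_(m < r.+1) (-1) ^+ m * 'C(r, m)%:R * (f m - f m.+1).
Proof.
rewrite big_ord_recl bin0 expr0 !mul1r.
under eq_bigr => i _ do rewrite /bump /= ?add1n binS natrD mulrDr mulrDl.
rewrite big_split /= [X in _ + (X + _)]big_ord_recr /= bin_small // mulr0 mul0r addr0.
under [RHS]eq_bigr => i _ do rewrite mulrBr.
rewrite sumrB [X in _ = X - _]big_ord_recl bin0 expr0 !mul1r -addrA; congr (_ + _).
rewrite -sumrN; congr (_ + _); apply: eq_bigr => i _.
by rewrite exprS; ring.
Qed.

Lemma altlog_step r s : altlog r.+1 s.+1 = altlog r s.+1 - altlog r s.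
Proof.
rewrite /altlog alt_bin_pascal opprK addrC -sumrB -sumrN; apply: eq_bigr => m _.
have -> : shifted_inv s.+1 m.+1 = shifted_inv s m by rewrite /shifted_inv ltnS !subSS.
by ring.
Qed.

(** Absorption, (r + 1) C(r, i) / (i + 1) = C(r + 1, i + 1), leaves a vanishing alternating sum
    short of its first term. *)
Lemma altlog0 r : (r.+1 < p)%N -> r.+1%:R * altlog r 0 = 1.
Proof.
move=> rp; have := alt_bin_sum r; rewrite big_ord_recl bin0 expr0 mul1r => /eqP; rewrite addr_eq0 => /eqP e.
transitivity (- \sum_(i < r.+1) (-1) ^+ bump 0 i * 'C(r.+1, bump 0 i)%:R : R); last first.
  by rewrite -e.
rewrite /altlog mulrN big_distrr /=; congr (- _); apply: eq_bigr => i _.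
have u : i.+1%:R \is a @GRing.unit R by apply: small_natr_unit; have := ltn_ord i; lia.
rewrite /shifted_inv ltn0 subn0 /bump /= ?add1n exprS.
transitivity (- (-1) ^+ i * (r.+1 * 'C(r, i))%N%:R * i.+1%:R^-1 : R); first by rewrite natrM; ring.
rewrite mul_bin_diag natrM; transitivity (- (-1) ^+ i * 'C(r.+1, i.+1)%:R * (i.+1%:R * i.+1%:R^-1) : R).
  by ring.
by rewrite divrr //; ring.
Qed.

Lemma altlog_max r : (r.+1 < p)%N -> r.+1%:R * altlog r r.+1 = (-1) ^+ r.+1.
Proof.
move=> rp; have := alt_bin_sum r; rewrite big_ord_recr /= binn mulr1 addrC.
move/eqP; rewrite addr_eq0 => /eqP e.
transitivity (- \sum_(i < r.+1) (-1) ^+ i * 'C(r.+1, i)%:R : R); last first.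
  by rewrite -e.
rewrite /altlog mulrN big_distrr /=; congr (- _); apply: eq_bigr => i _.
have ir := ltn_ord i.
have u : (r.+1 - i)%:R \is a @GRing.unit R by apply: small_natr_unit; lia.
rewrite /shifted_inv ir.
transitivity ((-1) ^+ i * (r.+1 * 'C(r, i))%N%:R * (r.+1 - i)%:R^-1 : R).
  by rewrite natrM; ring.
rewrite (mul_bin_down r.+1) natrM.
transitivity ((-1) ^+ i * 'C(r.+1, i)%:R * ((r.+1 - i)%:R * (r.+1 - i)%:R^-1) : R).
  by ring.
by rewrite divrr // mulr1.
Qed.

Lemma harm_shift k : (k.+1 < p)%N -> k.+1%:R * harm k.+1 = k.+1%:R * harm k + 1.
Proof.
move=> kp; rewrite harmS mulrDr divrr //; apply: small_natr_unit.
by rewrite kp.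
Qed.

(** Both sides obey the Pascal recursion of [altlog_step]; the end columns s = 0 and s = r + 1,
    which that recursion does not reach, are [altlog0] and [altlog_max]. *)
Lemma altlogE r s : (s <= r.+1)%N -> (r.+1 < p)%N ->
  r.+1%:R * altlog r s * (-1) ^+ s = 'C(r.+1, s)%:R *
   (1 + r.+1%:R * harm r.+1 - s%:R * harm s - (r.+1 - s)%:R * harm (r.+1 - s)).
Proof.
elim: r s => [|r IH] s sr rp.
  case: s sr => [|[|//]] _; first by rewrite altlog0 // bin0 subn0; ring.
  by rewrite altlog_max // subnn binn; ring.
case: s sr => [_|s sr]; first by rewrite altlog0 // bin0 subn0; ring.
case: (eqVneq s r.+1) => [->|sr1].
  rewrite altlog_max // -expr2 sqrr_sign binn subnn; ring.
have {}sr : (s <= r)%N by lia.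
rewrite altlog_step.
have := IH s.+1 sr (ltnW rp); have := IH s (leqW sr) (ltnW rp).
set F1 := altlog r s.+1; set F0 := altlog r s.
have -> : (r.+2 - s.+1 = (r - s).+1)%N by lia.
have -> : (r.+1 - s.+1 = r - s)%N by lia.
have -> : (r.+1 - s = (r - s).+1)%N by lia.
have h1 : r.+2%:R * harm r.+2 = r.+2%:R * harm r.+1 + 1 by apply: harm_shift.
have h2 : s.+1%:R * harm s.+1 = s.+1%:R * harm s + 1 by apply: harm_shift; lia.
have h3 : (r - s).+1%:R * harm (r - s).+1 = (r - s).+1%:R * harm (r - s) + 1.
  by apply: harm_shift; lia.
rewrite h1 h2 h3 => e0 e1.
have b1 : r.+2%:R * 'C(r.+1, s.+1)%:R = (r - s).+1%:R * 'C(r.+2, s.+1)%:R :> R.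
  by rewrite -!natrM (mul_bin_down r.+2); congr (_ * _)%:R; lia.
have b0 : r.+2%:R * 'C(r.+1, s)%:R = s.+1%:R * 'C(r.+2, s.+1)%:R :> R.
  by rewrite -!natrM (mul_bin_diag r.+2).
have u : r.+1%:R \is a @GRing.unit R by apply: small_natr_unit; lia.
apply: (mulrI u); rewrite exprS in e1 *.
transitivity (r.+2%:R * (r.+1%:R * F1 * (-1 * (-1) ^+ s)) + r.+2%:R * (r.+1%:R * F0 * (-1) ^+ s)).
  by ring.
rewrite e0 e1 !(mulrA r.+2%:R) b1 b0.
have qE : (r - s)%:R = r%:R - s%:R :> R by rewrite natrB.
by rewrite -!(natr1 (r - s)) -!(natr1 r.+1) -!(natr1 r) -!(natr1 s) !qE; ring.
Qed.


End AlternatingLog.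

End SquareZero.

(** * Character sums of the Legendre curve over Teichmuller representatives *)

Section Teichmuller.

Variables (R : comUnitRingType) (p n : nat).
Hypothesis p_prime : prime p.
Hypothesis p_odd : p = n.*2.+1.
Hypothesis p_sq0 : p%:R * p%:R = 0 :> R.

Let n0 : (0 < n)%N := n_gt0 p_prime p_odd.

Lemma p_bin_sign j : (j < p)%N -> p%:R * 'C(n.*2, j)%:R = p%:R * (-1) ^+ j :> R.
Proof.
elim: j => [|j IH] jp; first by rewrite bin0.
have u : j.+1%:R \is a @GRing.unit R by apply: (small_natr_unit p_prime p_sq0).
apply: (mulrI u); rewrite mulrCA -natrM mul_bin_left natrM mulrCA.
rewrite [in RHS]mulrCA exprS mulrA mulrCA mulrA -!mulrA IH; last exact: ltnW.
have -> : (n.*2 - j)%:R = p%:R - j.+1%:R :> R.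
  by rewrite -natrB 1?ltnW //; congr _%:R; lia.
transitivity ((p%:R * p%:R - p%:R * j.+1%:R) * (-1) ^+ j : R); first by ring.
by rewrite p_sq0; ring.
Qed.

(* The constant coefficient is 0, since 0^-1 = 0. *)
Definition fermat_poly : {poly R} := \poly_(k < p) - k%:R^-1.

(** C(p, k) = (p/k) C(p - 1, k - 1) and the last binomial is (-1)^(k-1) modulo p, so the correction
    is p times the truncated logarithm of 1 - x. *)
Lemma one_sub_expp x : x ^+ p = x -> (1 - x) ^+ p = 1 - x + p%:R * fermat_poly.[x].
Proof.
move=> xp; rewrite exprBn big_ord_recr /= binn expr1n mulr1 xp.
have -> : (-1) ^+ p = -1 :> R by rewrite -signr_odd p_odd /= odd_double.
rewrite horner_poly mulr1n mulN1r addrAC addrC mulr_sumr.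
have [r pr] : {r | p = r.+1} by exists n.*2.
have rn : r = n.*2 by lia.
move: p_bin_sign; rewrite pr -rn => pb.
rewrite !big_ord_recl /= !expr0 !expr1n invr0 bin0 mulr1n -!addrA !mulr1 oppr0 mulr0 add0r.
rewrite addrCA; congr (_ + _); rewrite addrC; congr (_ - _).
apply: eq_bigr => i _; have ir := ltn_ord i.
have u : i.+1%:R \is a @GRing.unit R.
  by apply: (small_natr_unit p_prime p_sq0); rewrite pr; lia.
rewrite /bump /= ?add1n expr1n mulr1; apply: (mulrI u).
transitivity ((-1) ^+ i.+1 * x ^+ i.+1 * (i.+1 * 'C(r.+1, i.+1))%N%:R : R).
  by rewrite natrM; ring.
rewrite -mul_bin_diag natrM /= pb; last by lia.
transitivity (- (i.+1%:R / i.+1%:R) * (r.+1%:R * x ^+ i.+1) : R); last by ring.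
rewrite divrr //; transitivity (- ((-1) ^+ i * (-1) ^+ i) * (r.+1%:R * x ^+ i.+1) : R).
  by rewrite exprS; ring.
by rewrite -expr2 sqrr_sign.
Qed.

Lemma exprD_sq0 (a b : R) r :
  (a + p%:R * b) ^+ r.+1 = a ^+ r.+1 + p%:R * (r.+1%:R * a ^+ r * b).
Proof.
elim: r => [|r IH]; first by rewrite !expr1 expr0; ring.
rewrite exprS IH.
transitivity (a ^+ r.+2 + p%:R * (r.+2%:R * a ^+ r.+1 * b) +
   (p%:R * p%:R) * (r.+1%:R * a ^+ r * b ^+ 2)).
  by rewrite -(natr1 r.+1) !exprS; ring.
by rewrite p_sq0 mul0r addr0.
Qed.

Definition log_poly : {poly R} := n%:R%:P * ((1 - 1%:P * 'X) ^+ n.-1 * fermat_poly).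

Lemma one_sub_exppn x : x ^+ p = x ->
  (1 - x) ^+ (p * n) = (1 - x) ^+ n + p%:R * log_poly.[x].
Proof.
move=> xp; rewrite exprM one_sub_expp // -(prednK n0) exprD_sq0 prednK //.
rewrite /log_poly !(hornerM, hornerC, horner_exp, hornerD, hornerN, hornerX) !mul1r.
by ring.
Qed.

Lemma coefM_wide k (q r : {poly R}) i : (size q <= k)%N ->
  (q * r)`_i = \sum_(m < k) q`_m * (if (m <= i)%N then r`_(i - m) else 0).
Proof.
move=> sq; have {1}-> : q = \sum_(m < k) q`_m *: 'X^m.
  rewrite -poly_def; apply/polyP => j; rewrite coef_poly; case: ltnP => // kj.
  by rewrite nth_default //; apply: leq_trans kj.
rewrite mulr_suml coef_sum; apply: eq_bigr => m _.
by rewrite -scalerAl coefZ coefXnM; case: ltnP.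
Qed.

Lemma size_one_sub_exp (c : R) k : (size ((1 - c%:P * 'X) ^+ k) <= k.+1)%N.
Proof.
by apply/leq_sizeP => j kj; rewrite coef_one_sub_exp bin_small // mulr0.
Qed.

Lemma coef_log_poly i : log_poly`_i =
  n%:R * \sum_(m < n) (-1) ^+ m * 'C(n.-1, m)%:R *
    (if (m <= i)%N then (if (i - m < p)%N then - (i - m)%:R^-1 else 0) else 0).
Proof.
rewrite coefCM (@coefM_wide n); last by rewrite -{2}(prednK n0) size_one_sub_exp.
congr (_ * _); apply: eq_bigr => m _; rewrite coef_one_sub_exp.
by rewrite coef_poly.
Qed.

(** On Teichmuller representatives x^(2n) = 1, and [log_poly] has degree below 3n, so the exponent s
    collects s and s + 2n. For m < s only the first contributes, with denominator s - m; for m >= s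
    only the second, with denominator p - (m + 1 - s). This is the origin of [shifted_inv]. *)
Lemma p_log_poly s : (s <= n)%N ->
  p%:R * (log_poly`_s + log_poly`_(s + n.*2)) =
  p%:R * ((-1) ^+ s * 'C(n, s)%:R * logcoef R n s).
Proof.
move=> sn.
have np : (n.-1.+1 < p)%N by rewrite prednK //; lia.
have snp : (s <= n.-1.+1)%N by rewrite prednK.
have := altlogE p_prime p_odd p_sq0 snp np; rewrite prednK // => e.
transitivity (p%:R * ((-1) ^+ s * (n%:R * altlog R n.-1 s * (-1) ^+ s))); last first.
  by rewrite e /logcoef; ring.
transitivity (p%:R * (((-1) ^+ s) ^+ 2 * (n%:R * altlog R n.-1 s))); last by ring.
rewrite sqrr_sign mul1r /altlog prednK // !coef_log_poly -mulrDr -big_split /=.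
rewrite mulrCA [in RHS]mulrCA; congr (_ * _).
rewrite -sumrN !mulr_sumr; apply: eq_bigr => m _; rewrite -mulrDr mulrCA.
rewrite -mulrN [in RHS]mulrCA; congr (_ * _); have mn := ltn_ord m.
have -> : (m <= s + n.*2)%N by lia.
rewrite /shifted_inv; case: (ltnP m s) => ms.
  rewrite ltnW // ifT; last by lia.
  by rewrite ifF; [rewrite addr0 | lia].
have u1 : (m.+1 - s)%:R \is a @GRing.unit R by apply: (small_natr_unit p_prime p_sq0); lia.
have u2 : (s + n.*2 - m)%:R \is a @GRing.unit R.
  by apply: (small_natr_unit p_prime p_sq0); lia.
have -> : (if (m <= s)%N then if (s - m < p)%N then - (s - m)%:R^-1 else 0 else 0) = 0 :> R.
  case: (leqP m s) => // ms'; have -> : (s - m = 0)%N by lia.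
  by rewrite invr0 oppr0; case: ifP.
rewrite ifT; last by lia.
apply: (mulrI u1); apply: (mulrI u2); set a := (m.+1 - s)%:R in u1 *; set b := (s + _ - _)%:R in u2 *.
(* Hence p/b = -p/a, as p^2 = 0. *)
have ab : a + b = p%:R by rewrite -natrD; congr _%:R; lia.
transitivity (- (b / b) * (a * p%:R)); first by ring.
transitivity ((a / a) * (b * p%:R)); last by ring.
rewrite !divrr // -[b](addKr a) ab mulrDl p_sq0; ring.
Qed.


Section Sum.

Variables (I : finType) (A : {pred I}) (tau : I -> R).
Hypothesis tau_p : forall i, i \in A -> tau i ^+ p = tau i.
Hypothesis tau_sum : forall k,
  \sum_(i in A) tau i ^+ k = if (n.*2 %| k)%N then n.*2%:R else 0.

(** For j < 5n, n + j is a multiple of 2n only when j = n or j = 3n. *)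
Lemma tau_horner (q : {poly R}) : (size q <= 5 * n)%N ->
  \sum_(i in A) tau i ^+ n * q.[tau i] = n.*2%:R * (q`_n + q`_(n + n.*2)).
Proof.
move=> sq; under eq_bigr => i _ do rewrite (horner_coef_wide _ sq) mulr_sumr.
rewrite exchange_big /=.
have E (j : 'I_(5 * n)) : \sum_(i in A) tau i ^+ n * (q`_j * tau i ^+ j) =
   (if (j == n :> nat) then n.*2%:R * q`_j else 0) +
   (if (j == n + n.*2 :> nat)%N then n.*2%:R * q`_j else 0).
  under eq_bigr => i _ do rewrite mulrCA -exprD.
  rewrite -mulr_sumr tau_sum; have j5 := ltn_ord j.
  have -> : (n.*2 %| n + j)%N = (j == n :> nat) || (j == n + n.*2 :> nat)%N.
    apply/idP/idP => [/dvdnP [k kE]|/orP [/eqP -> | /eqP ->]]; last 2 first.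
    - by rewrite addnn.
    - by rewrite addnA addnn dvdn_add.
    have k1 : (0 < k)%N by case: k kE => //; lia.
    have k3 : (k < 3)%N.
      rewrite ltnNge; apply/negP => k3; have := leq_mul k3 (leqnn n.*2); lia.
    have [k_1|k_2] : k = 1 \/ k = 2 by lia.
      by apply/orP; left; rewrite k_1 in kE; lia.
    by apply/orP; right; rewrite k_2 in kE; lia.
  case: eqP => [->|_] /=; last by case: eqP => _; ring.
  by rewrite (_ : (n == n + n.*2)%N = false); [ring | lia].
rewrite (eq_bigr _ (fun j _ => E j)) big_split /= -!big_mkcond /=.
have n5 : (n < 5 * n)%N by lia.
have n35 : (n + n.*2 < 5 * n)%N by lia.
rewrite (big_pred1 (Ordinal n5)) // (big_pred1 (Ordinal n35)) //.
by rewrite mulrDr.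
Qed.

(** Expand both factors to first order in p. The two cross terms are equal, since [gcoef] and
    [logcoef] are invariant under s -> n - s, and 2n = p - 1 acts as -1 on multiples of p. *)
Lemma tau_legendre_sum t : t ^+ n.*2 = 1 ->
  \sum_(i in A) tau i ^+ n * (1 - tau i) ^+ (p * n) * (1 - t * tau i) ^+ (p * n) =
  (-1) ^+ n * (n.*2%:R * (gpoly R n).[t] -
    2 * (p%:R * \sum_(s < n.+1) gcoef R n s * logcoef R n s * t ^+ s)).
Proof.
move=> t1; have tp : t ^+ p = t by rewrite p_odd exprS t1 mulr1.
pose a : {poly R} := (1 - 1%:P * 'X) ^+ n; pose b : {poly R} := (1 - t%:P * 'X) ^+ n.
pose c : {poly R} := log_poly \Po (t%:P * 'X).
have sa : (size a <= n.+1)%N by apply: size_one_sub_exp.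
have sb : (size b <= n.+1)%N by apply: size_one_sub_exp.
have sl : (size log_poly <= n + n.*2)%N.
  apply/leq_sizeP => j nj; rewrite coef_log_poly big1 ?mulr0 // => m _.
  have mn := ltn_ord m; rewrite ifT; last by lia.
  by rewrite ifF ?mulr0 //; lia.
have cE j : c`_j = t ^+ j * log_poly`_j.
  have -> : c = \poly_(j < size log_poly) (t ^+ j * log_poly`_j).
    rewrite /c comp_polyE poly_def; apply: eq_bigr => k _.
    by rewrite exprMn -polyC_exp -!mul_polyC polyCM; ring.
  by rewrite coef_poly; case: ltnP => // /(nth_default 0) ->; rewrite mulr0.
have sc : (size c <= n + n.*2)%N.
  by apply/leq_sizeP => j nj; rewrite cE nth_default ?mulr0 // (leq_trans sl).
have aX x : a.[x] = (1 - x) ^+ n.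
  by rewrite /a !(horner_exp, hornerD, hornerN, hornerM, hornerC, hornerX) mul1r.
have bX x : b.[x] = (1 - t * x) ^+ n.
  by rewrite /b !(horner_exp, hornerD, hornerN, hornerM, hornerC, hornerX).
have cX x : c.[x] = log_poly.[t * x] by rewrite /c horner_comp; congr _.[_]; rewrite hornerM hornerC hornerX.
transitivity (\sum_(i in A) (tau i ^+ n * (b * a).[tau i] +
   p%:R * (tau i ^+ n * (b * log_poly).[tau i] + tau i ^+ n * (a * c).[tau i]))).
  apply: eq_bigr => i iA; rewrite !one_sub_exppn ?exprMn ?tau_p ?tp //.
  rewrite (hornerM b a) (hornerM b) (hornerM a) aX bX cX.
  set x := (1 - tau i) ^+ n; set y := (1 - t * tau i) ^+ n.
  set L1 := log_poly.[_]; set L2 := log_poly.[_].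
  transitivity (tau i ^+ n * (y * x) + p%:R * (tau i ^+ n * (y * L1) + tau i ^+ n * (x * L2))
    + p%:R * p%:R * (tau i ^+ n * L1 * L2)); first by ring.
  by rewrite p_sq0 mul0r addr0.
rewrite big_split /= -mulr_sumr big_split /=.
have size_le5 (q r : {poly R}) : (size q <= n.+1)%N -> (size r <= n + n.*2)%N -> (size (q * r)%R <= 5 * n)%N.
  by move=> sq sr; apply: leq_trans (size_polyMleq _ _) _; lia.
rewrite !tau_horner ?size_le5 //; last by apply: leq_trans sa _; lia.
have aE j : a`_j = (-1) ^+ j * 'C(n, j)%:R by apply: coef_one_sub_exp.
have bE j : b`_j = (- t) ^+ j * 'C(n, j)%:R by apply: coef_one_sub_exp.
have c0 : (b * a)`_n = (-1) ^+ n * (gpoly R n).[t].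
  rewrite (coefM_wide _ _ sb) (horner_wide _ (size_gpoly R n)) mulr_sumr.
  apply: eq_bigr => j _; have jn : (j <= n)%N by rewrite -ltnS.
  rewrite jn aE bE coef_gpoly /gcoef bin_sub // (exprNn t).
  have -> : (-1) ^+ n = (-1) ^+ (n - j) * (-1) ^+ j :> R by rewrite -exprD subnK.
  by ring.
have c0' : (b * a)`_(n + n.*2) = 0.
  by rewrite nth_default //; apply: leq_trans (size_polyMleq _ _) _; lia.
have coef_pair (q r : {poly R}) : (size q <= n.+1)%N ->
   (q * r)`_n + (q * r)`_(n + n.*2) = \sum_(j < n.+1) q`_j * (r`_(n - j) + r`_(n - j + n.*2)).
  move=> sq; rewrite !(coefM_wide _ _ sq) -big_split /=; apply: eq_bigr => j _.
  have jn : (j <= n)%N by rewrite -ltnS.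
  by rewrite jn ifT; [rewrite -addnBAC // mulrDr | lia].
have lsym s : (s <= n)%N -> logcoef R n (n - s) = logcoef R n s.
  by move=> sn; rewrite /logcoef subKn //; ring.
pose W := p%:R * \sum_(s < n.+1) gcoef R n s * logcoef R n s * t ^+ s.
have c1 : p%:R * ((b * log_poly)`_n + (b * log_poly)`_(n + n.*2)) = (-1) ^+ n * W.
  rewrite coef_pair // /W mulrCA !mulr_sumr; apply: eq_bigr => j _.
  have jn : (j <= n)%N by rewrite -ltnS.
  rewrite (mulrCA p%:R b`_j) p_log_poly ?leq_subr // bE bin_sub // lsym // (exprNn t) /gcoef.
  have -> : (-1) ^+ n = (-1) ^+ (n - j) * (-1) ^+ j :> R by rewrite -exprD subnK.
  by ring.
have c2 : p%:R * ((a * c)`_n + (a * c)`_(n + n.*2)) = (-1) ^+ n * W.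
  rewrite coef_pair // /W (reindex_inj rev_ord_inj) mulrCA !mulr_sumr; apply: eq_bigr => j _.
  have jn : (j <= n)%N by rewrite -ltnS.
  have -> : nat_of_ord (rev_ord j) = (n - j)%N by rewrite /= subSS.
  rewrite subKn // !cE exprD t1 mulr1 -mulrDr.
  transitivity (a`_(n - j) * t ^+ j * (p%:R * (log_poly`_j + log_poly`_(j + n.*2)))); first by ring.
  rewrite p_log_poly //.
  rewrite aE bin_sub // /gcoef; have -> : (-1) ^+ n = (-1) ^+ (n - j) * (-1) ^+ j :> R by rewrite -exprD subnK.
  by ring.
rewrite -mulrDr (mulrCA p%:R) (mulrDr p%:R) c1 c2 c0 c0' -/W.
have -> : n.*2%:R = p%:R - 1 :> R by rewrite p_odd -natr1; ring.
have pW : p%:R * W = 0 by rewrite /W mulrA p_sq0 mul0r.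
transitivity ((-1) ^+ n * ((p%:R - 1) * (gpoly R n).[t] - 2 * W) + 2 * (-1) ^+ n * (p%:R * W)).
  by ring.
by rewrite pW mulr0 addr0.
Qed.

(* The sum is, up to sign, the trace of Frobenius of the curve with parameter t, so
   [hpoly] at t is a root of its characteristic polynomial X^2 - trace X + p. *)
Lemma tau_legendre_fix m t : n = (3 * m)%N -> t ^+ 2 = t - 1 ->
  (-1) ^+ n.+1 * (\sum_(i in A) tau i ^+ n * (1 - tau i) ^+ (p * n) * (1 - t * tau i) ^+ (p * n))
   * (hpoly R n).[t] = (hpoly R n).[t] ^+ 2 + p%:R.
Proof.
move=> n_3m t_sq; rewrite tau_legendre_sum; last first.
  by rewrite -muln2 exprM (sixth_root_expn n_3m t_sq) sqrr_sign.
have := logcoef_sum p_prime p_odd p_sq0 n_3m t_sq.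
rewrite (gpoly_fix p_prime p_odd n_3m t_sq); set H := _.[t]; set W := p%:R * _ => e.
have -> : n.*2%:R = p%:R - 1 :> R by rewrite p_odd -natr1; ring.
transitivity (((-1) ^+ n) ^+ 2 * (H ^+ 2 - p%:R * H ^+ 2 + 2 * H * W)); first by rewrite exprS; ring.
by rewrite e sqrr_sign; ring.
Qed.

End Sum.

End Teichmuller.

(** * Cubic character sums and the representation p = A^2 + 3 B^2 *)

Lemma odd_of_mod4 (c e N : int) : (e = 1 \/ e = -1) ->
  (c = 2 * N + 1 - 1 + e %[mod 4])%Z -> exists k, c = 2 * k + 1.
Proof. by move=> e1 h; exists (c %/ 2)%Z; case: e1 h => ->; lia. Qed.

Section CharacterSums.

Variables (p n m : nat).
Hypothesis p_prime : prime p.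
Hypothesis p_odd : p = n.*2.+1.
Hypothesis n_3m : n = (3 * m)%N.

Let m_gt0 : (0 < m)%N.
Proof. by have := prime_gt1 p_prime; rewrite p_odd n_3m; case: (m). Qed.
Let n_gt0 : (0 < n)%N. Proof. by rewrite n_3m; lia. Qed.

Let pZ : p%:Z = 2 * n%:Z + 1. Proof. by rewrite p_odd; lia. Qed.

Lemma natrFp_eq0 k : (k%:R == 0 :> 'F_p) = (p %| k)%N.
Proof. by rewrite -(dvdn_pcharf (pchar_Fp p_prime)). Qed.

Lemma small_natrFp k : (0 < k < p)%N -> k%:R != 0 :> 'F_p.
Proof. by case/andP=> k0 kp; rewrite natrFp_eq0 gtnNdvd. Qed.

Lemma intrFp_eq0 (z : int) : (z%:~R == 0 :> 'F_p) = (p%:Z %| z)%Z.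
Proof.
case: z => k; first by rewrite -pmulrn natrFp_eq0 dvdzE.
by rewrite NegzE mulrNz oppr_eq0 -pmulrn natrFp_eq0 dvdzE.
Qed.

Lemma fermatFp (a : 'F_p) : a != 0 -> a ^+ n.*2 = 1.
Proof.
move=> a0; apply: (mulfI a0); rewrite mulr1 -exprS -p_odd.
by rewrite -{2}[a]expf_card card_Fp.
Qed.

Lemma neg1_neq1 : -1 != 1 :> 'F_p.
Proof.
rewrite eq_sym -subr_eq0 opprK -[1 + 1]/(2%:R) small_natrFp //=.
by rewrite p_odd; lia.
Qed.

Lemma expn_pm1 (a : 'F_p) : a != 0 -> (a ^+ n == 1) || (a ^+ n == -1).
Proof. by move=> /fermatFp; rewrite -muln2 exprM => /eqP; rewrite sqrf_eq1. Qed.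

Definition chi (a : 'F_p) : int := if a == 0 then 0 else if a ^+ n == 1 then 1 else -1.

Lemma chi0 : chi 0 = 0. Proof. by rewrite /chi eqxx. Qed.
Lemma chi1 : chi 1 = 1. Proof. by rewrite /chi oner_eq0 expr1n eqxx. Qed.

Lemma chi_eq (a : 'F_p) : (chi a)%:~R = a ^+ n.
Proof.
rewrite /chi; case: eqP => [->|/eqP a0]; first by rewrite expr0n; case: (n) n_gt0.
by case: eqP (expn_pm1 a0) => [->|_] // /eqP ->.
Qed.

Lemma chi_pm1 (a : 'F_p) : a != 0 -> chi a = 1 \/ chi a = -1.
Proof. by rewrite /chi => /negbTE ->; case: ifP; [left | right]. Qed.

(** Allows identities between values of [chi] to be checked in ['F_p], where [chi] is the n-th
    power. *)
Lemma chi_inj (z w : int) : (z = 0 \/ z = 1 \/ z = -1) -> (w = 0 \/ w = 1 \/ w = -1) ->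
  z%:~R = w%:~R :> 'F_p -> z = w.
Proof.
have h1 := neg1_neq1; have h2 : 1 != 0 :> 'F_p := oner_neq0 _.
have h3 : -1 != 0 :> 'F_p by rewrite oppr_eq0.
move=> hz hw; case: hz => [|[|]] ->; case: hw => [|[|]] -> //.
all: rewrite ?mulrNz ?mulr1z ?mulr0z => /eqP; rewrite ?(negbTE h1) ?(negbTE h2) ?(negbTE h3) //.
all: by rewrite eq_sym ?(negbTE h1) ?(negbTE h2) ?(negbTE h3).
Qed.

Lemma chi_cases a : chi a = 0 \/ chi a = 1 \/ chi a = -1.
Proof. by rewrite /chi; do 2?case: ifP; auto. Qed.

Lemma chiM a b : chi (a * b) = chi a * chi b.
Proof.
apply: chi_inj; first exact: chi_cases.
  by case: (chi_cases a) => [|[|]] ->; case: (chi_cases b) => [|[|]] ->; auto.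
by rewrite intrM !chi_eq exprMn.
Qed.

Lemma chi_neq0_sq a : a != 0 -> chi a * chi a = 1.
Proof. by case/chi_pm1 => ->. Qed.

Lemma chiX2 a : a != 0 -> chi (a ^+ 2) = 1.
Proof. by move=> a0; rewrite expr2 chiM chi_neq0_sq. Qed.

Lemma chiX3 a : chi (a ^+ 3) = chi a.
Proof. by rewrite !exprS mulr1 !chiM; case: (chi_cases a) => [|[|]] ->. Qed.

Lemma chiN1 : chi (-1) = (-1) ^+ n.
Proof.
apply: chi_inj; first exact: chi_cases.
  by rewrite -signr_odd; case: (odd n); auto.
by rewrite chi_eq rmorphXn /= mulrNz.
Qed.

Lemma chi_prod (I : Type) (r : seq I) (P : pred I) (f : I -> 'F_p) :
  chi (\prod_(i <- r | P i) f i) = \prod_(i <- r | P i) chi (f i).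
Proof. exact: (big_morph chi chiM chi1). Qed.

Lemma primitive_exists : exists g : 'F_p, n.*2.-primitive_root g.
Proof.
have u : uniq [seq a <- enum 'F_p | a != 0] by rewrite filter_uniq ?enum_uniq.
have /hasP[g _ gp] : has n.*2.-primitive_root [seq a <- enum 'F_p | a != 0].
  apply: has_prim_root; rewrite ?double_gt0 //.
  - by apply/allP => a; rewrite mem_filter => /andP[a0 _]; rewrite unity_rootE fermatFp.
  rewrite -(card_uniqP u).
  rewrite (eq_card (B := predC1 0)) => [|x]; first by rewrite cardC1 card_Fp // p_odd.
  by rewrite mem_filter mem_enum !inE andbT.
by exists g.
Qed.

Lemma three_neq0 : 3%:R != 0 :> 'F_p.
Proof. by apply: small_natrFp; rewrite p_odd n_3m; lia. Qed.

Lemma six_neq0 : 6%:R != 0 :> 'F_p.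
Proof. by apply: small_natrFp; rewrite p_odd n_3m; lia. Qed.

Lemma double_n3 : n.*2 = (3 * m.*2)%N.
Proof. by rewrite n_3m -!mul2n mulnCA. Qed.

Section Generator.

Variable g : 'F_p.
Hypothesis g_prim : n.*2.-primitive_root g.

Lemma gen_neq0 : g != 0.
Proof.
by apply: contra_eq_neq (prim_expr_order g_prim) => ->; rewrite expr0n double_eq0 gtn_eqF // eq_sym oner_eq0.
Qed.

Lemma gen_expn : g ^+ n = -1.
Proof.
case/orP: (expn_pm1 gen_neq0) => /eqP // e; have := prim_order_dvd g_prim n.
rewrite e eqxx => /dvdn_leq; lia.
Qed.

Lemma chi_gen : chi g = -1.
Proof. by rewrite /chi (negbTE gen_neq0) gen_expn (negbTE neg1_neq1). Qed.

Lemma big_gen (V : Type) (idx : V) (op : Monoid.com_law idx) (f : 'F_p -> V) :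
  \big[op/idx]_(a | a != 0) f a = \big[op/idx]_(j < n.*2) f (g ^+ j).
Proof.
have inj : injective (fun j : 'I_n.*2 => g ^+ j).
  move=> i j /eqP; rewrite (eq_prim_root_expr g_prim) !modn_small //.
  by move=> /eqP /val_inj.
transitivity (\big[op/idx]_(j in [set: 'I_n.*2]) f (g ^+ j)); last first.
  by apply: eq_bigl => j; rewrite inE.
rewrite -(big_imset f (A := [set: 'I_n.*2]) (in2W inj)).
apply: eq_bigl => a; have -> : (fun j : 'I_n.*2 => g ^+ j) @: [set: 'I_n.*2] = [set~ 0].
  apply/eqP; rewrite eqEcard; apply/andP; split.
    by apply/subsetP => x /imsetP[j _ ->]; rewrite !inE expf_neq0 ?gen_neq0.
  by rewrite card_imset // cardsT card_ord cardsC1 card_Fp // p_odd.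
by rewrite !inE.
Qed.

Lemma sum_chi : \sum_a chi a = 0.
Proof.
have inj : injective (fun a : 'F_p => g * a) by apply: mulfI gen_neq0.
have e : \sum_a chi a = - \sum_a chi a.
  rewrite {1}(reindex_inj inj) /= -sumrN; apply: eq_bigr => a _.
  by rewrite chiM chi_gen mulN1r.
lia.
Qed.

(** For d = s - r nonzero, c (c + d) = c^2 (1 + d/c), and 1 + d/c takes every value except 1. *)
Lemma sum_chi_shift2 (r s : 'F_p) :
  \sum_c chi (c + r) * chi (c + s) = if r == s then p%:Z - 1 else -1.
Proof.
rewrite (reindex_inj (addIr (- r))) /=.
under eq_bigr => c _ do rewrite subrK -addrA -chiM.
set d := - r + s.
rewrite (bigD1 0) //= mul0r chi0 add0r.
have eqrs : (r == s) = (d == 0) by rewrite /d addrC subr_eq0 eq_sym.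
rewrite eqrs; case: eqP => [-> | /eqP d0].
  transitivity (\sum_(c : 'F_p | c != 0) (1 : int)).
    by apply: eq_bigr => c c0; rewrite addr0 chiM chi_neq0_sq.
  by rewrite sumr_const cardC1 card_Fp // natz p_odd /=; lia.
have injd : injective (fun u : 'F_p => d / (u - 1)).
  by move=> u v /(mulfI d0) /invr_inj /addIr.
transitivity (\sum_(c : 'F_p | c != 0) chi (1 + d / c)).
  apply: eq_bigr => c c0; have -> : c * (c + d) = c ^+ 2 * (1 + d / c) by field.
  by rewrite chiM chiX2 // mul1r.
rewrite (reindex_inj injd) /=.
transitivity (\sum_(u : 'F_p | u != 1) chi u).
  apply: eq_big => [u|u u1].
    by rewrite mulf_eq0 (negbTE d0) invr_eq0 subr_eq0.
  by congr chi; rewrite invf_div mulrCA mulfV // mulr1 addrC subrK.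
by have := sum_chi; rewrite (bigD1 1) //= chi1 => /eqP; rewrite addr_eq0 => /eqP e; rewrite [in RHS]e opprK.
Qed.

(** For c nonzero, minus the trace of Frobenius of the curve y^2 = v^3 + c. *)
Definition cubic_sum (c : 'F_p) : int := \sum_v chi (v ^+ 3 + c).
Notation S := cubic_sum.

Lemma cubic_sum0 : S 0 = 0.
Proof. by rewrite /S; under eq_bigr => v _ do rewrite addr0 chiX3; exact: sum_chi. Qed.

Lemma cubic_sum_scale c d : d != 0 -> S (c * d ^+ 3) = chi d * S c.
Proof.
move=> d0; rewrite /S (reindex_inj (mulIf d0)) mulr_sumr /=; apply: eq_bigr => v _.
by rewrite exprMn -mulrDl chiM chiX3 mulrC.
Qed.

Local Notation T j := (cubic_sum (g ^+ j)).

Lemma cubic_big_gen3 j : T (j + 3) = - T j.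
Proof. by rewrite exprD cubic_sum_scale ?gen_neq0 // chi_gen mulN1r. Qed.

Lemma sum_period3 (f : nat -> int) q : (forall j, f (j + 3)%N = f j) ->
  \sum_(j < 3 * q) f j = q%:Z * (f 0%N + f 1%N + f 2%N).
Proof.
move=> per; have perq i k : f (3 * k + i)%N = f i.
  by elim: k => [|k IH] //; rewrite -[RHS]IH -[RHS]per; congr f; lia.
elim: q => [|q IH]; first by rewrite muln0 big_ord0 mul0r.
rewrite mulnS addnC big_split_ord /= IH !big_ord_recr big_ord0 /= !perq.
by rewrite add0r intS; ring.
Qed.

(** Compute the sum of chi(c) S(c) over c in two ways: it is 0 by [sum_chi_shift2], and chi(c) S(c)
    depends only on the class of c modulo cubes. Even exponents are used because T 4 = - T 1. *)
Lemma cubic_sum_linear : T 0 + T 2 + T 4 = 0.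
Proof.
have e : \sum_(c : 'F_p) chi c * S c = 0.
  rewrite /S; under eq_bigr => c _ do rewrite mulr_sumr.
  rewrite exchange_big /= (bigD1 0) //=.
  under eq_bigr => c _ do rewrite expr0n /= add0r -[in X in X * _](addr0 c) -{2}(addr0 c).
  rewrite sum_chi_shift2 eqxx.
  under eq_bigr => v v0.
    under eq_bigr => c _ do rewrite -{1}(addr0 c) [v ^+ 3 + c]addrC.
    rewrite sum_chi_shift2 eq_sym expf_eq0 /= (negbTE v0); over.
  by rewrite sumr_const cardC1 card_Fp // p_odd /=; lia.
rewrite (bigD1 0) //= chi0 mul0r add0r big_gen double_n3 in e.
rewrite (@sum_period3 (fun j => chi (g ^+ j) * S (g ^+ j))) in e; last first.
  by move=> j; rewrite (cubic_big_gen3 j) exprD chiM chiX3 chi_gen; ring.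
have c0 : chi (g ^+ 0) = 1 by rewrite expr0 chi1.
have c1 : chi (g ^+ 1) = -1 by rewrite expr1 chi_gen.
have c2 : chi (g ^+ 2) = 1 by rewrite chiX2 ?gen_neq0.
rewrite c0 c1 c2 in e.
have e4 : T 4 = - T 1 := cubic_big_gen3 1.
have {}e : m.*2%:Z * (T 0 + T 2 + T 4) = 0 by rewrite e4 -[RHS]e; ring.
by move/eqP: e; rewrite mulf_eq0 => /orP[|/eqP //]; have := m_gt0; lia.
Qed.

Local Notation w := (g ^+ m.*2).

Lemma gen_pow_neq1 k : (0 < k < 3)%N -> g ^+ (k * m.*2) != 1.
Proof.
case/andP=> k0 k3; rewrite -(prim_order_dvd g_prim) gtnNdvd //; rewrite ?double_n3; nia.
Qed.

Lemma cube_root_eq : w ^+ 2 + w + 1 = 0.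
Proof.
have w3 : w ^+ 3 = 1 by rewrite -exprM mulnC -double_n3 prim_expr_order.
have w1 : w - 1 != 0 by rewrite subr_eq0; have := @gen_pow_neq1 1 isT; rewrite mul1n.
apply: (mulfI w1); rewrite mulr0; transitivity (w ^+ 3 - 1); first by ring.
by rewrite w3 subrr.
Qed.

Lemma cube_root_neq0 : w != 0. Proof. by rewrite expf_neq0 ?gen_neq0. Qed.

Lemma cube_root_neq1 : w - 1 != 0.
Proof. by rewrite subr_eq0; have := @gen_pow_neq1 1 isT; rewrite mul1n. Qed.

Lemma card_cube_fiber (v : 'F_p) : v != 0 ->
  \sum_(u : 'F_p) (u ^+ 3 == v ^+ 3)%:Z = 3.
Proof.
have w0 := cube_root_neq0; have w1 : w != 1 by have := @gen_pow_neq1 1 isT; rewrite mul1n.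
have w2 : w ^+ 2 != 1 by have := @gen_pow_neq1 2 isT; rewrite mulnC exprM.
move=> v0.
have e u : (u ^+ 3 == v ^+ 3) = [|| u == v, u == w * v | u == w ^+ 2 * v].
  rewrite -subr_eq0 -!(subr_eq0 u) -!mulf_eq0; congr (_ == 0).
  transitivity (u ^+ 3 - v ^+ 3 - (w ^+ 2 + w + 1) *
    (u ^+ 2 * v - w * u * v ^+ 2 + (w - 1) * v ^+ 3)); last by ring.
  by rewrite cube_root_eq mul0r subr0.
have d1 : v != w * v.
  by rewrite -subr_eq0 -{1}(mul1r v) -mulrBl mulf_neq0 // subr_eq0 eq_sym.
have d2 : v != w ^+ 2 * v.
  by rewrite -subr_eq0 -{1}(mul1r v) -mulrBl mulf_neq0 // subr_eq0 eq_sym.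
have d3 : w * v != w ^+ 2 * v.
  by rewrite expr2 -mulrA (inj_eq (mulfI w0)).
have one a : \sum_(u : 'F_p) (u == a)%:Z = 1.
  by rewrite (bigD1 a) //= eqxx big1 // => u /negbTE ->.
rewrite -[RHS]/(1 + (1 + 1)) -{1}(one v) -{1}(one (w * v)) -(one (w ^+ 2 * v)) -!big_split /=.
apply: eq_bigr => u _; rewrite e.
case: (eqVneq u v) => [->|_]; first by rewrite (negbTE d1) (negbTE d2).
by case: (eqVneq u (w * v)) => [->|_]; first by rewrite (negbTE d3).
Qed.

(** The second moment of S counts the pairs with u^3 = v^3, which gives 2 p (p - 1); S^2 is constant
    on the three classes modulo cubes, each of size 2m = (p - 1)/3. *)
Lemma cubic_sum_square : T 0 ^+ 2 + T 2 ^+ 2 + T 4 ^+ 2 = 6 * p%:Z.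
Proof.
have e : \sum_(c : 'F_p) S c ^+ 2 = 2 * p%:Z * (p%:Z - 1).
  transitivity (\sum_(u : 'F_p) \sum_(v : 'F_p) \sum_(c : 'F_p) chi (c + u ^+ 3) * chi (c + v ^+ 3)).
    under [RHS]eq_bigr => u _ do rewrite exchange_big.
    rewrite [RHS]exchange_big; apply: eq_bigr => c _.
    rewrite expr2 mulr_suml; apply: eq_bigr => u _.
    by rewrite mulr_sumr; apply: eq_bigr => v _; rewrite -![c + _]addrC.
  transitivity (\sum_(v : 'F_p) (p%:Z * \sum_(u : 'F_p) (u ^+ 3 == v ^+ 3)%:Z - p%:Z)).
    rewrite exchange_big; apply: eq_bigr => v _.
    have pE : p%:Z = \sum_(u : 'F_p) 1 by rewrite sumr_const card_Fp // natz.
    rewrite mulr_sumr [X in _ - X]pE -sumrB.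
    by apply: eq_bigr => u _; rewrite sum_chi_shift2; case: eqP => _ /=; ring.
  rewrite (bigD1 0) //=.
  have -> : \sum_(u : 'F_p) (u ^+ 3 == 0 ^+ 3)%:Z = 1.
    by rewrite (bigD1 0) //= big1 ?addr0 ?eqxx // => u /negbTE u0; rewrite expr0n expf_eq0 /= u0.
  under eq_bigr => v v0 do rewrite card_cube_fiber //.
  by rewrite sumr_const cardC1 card_Fp // -mulr_natr natz p_odd /=; lia.
rewrite (bigD1 0) //= cubic_sum0 expr0n add0r big_gen double_n3 in e.
rewrite (@sum_period3 (fun j => T j ^+ 2)) in e; last first.
  by move=> j; rewrite cubic_big_gen3 sqrrN.
have e4 : T 4 = - T 1 := cubic_big_gen3 1.
have m0 : m.*2%:Z != 0 by have := m_gt0; lia.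
apply: (mulfI m0); rewrite e4 sqrrN; transitivity (2 * p%:Z * (p%:Z - 1)).
  by rewrite -e; ring.
by rewrite p_odd n_3m; lia.
Qed.

(** Turning a 1 into -1 changes the sum by 2 and negates the product, which modulo 4 is also a
    change by 2. *)
Lemma sum_mod4 (I : Type) (r : seq I) (f : I -> int) :
  (forall i, f i = 1 \/ f i = -1) ->
  (\sum_(i <- r) f i = (size r)%:Z - 1 + \prod_(i <- r) f i %[mod 4])%Z.
Proof.
move=> f1; suff [] : (4 %| (\sum_(i <- r) f i - ((size r)%:Z - 1 + \prod_(i <- r) f i)))%Z /\
    (\prod_(i <- r) f i = 1 \/ \prod_(i <- r) f i = -1).
  by move=> h _; apply/eqP; rewrite eqz_mod_dvd.
elim: r => [|i r [/dvdzP[k IH] IH2]]; first by rewrite !big_nil; split; [|left].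
rewrite !big_cons /= intS.
split; last by case: (f1 i) => ->; case: IH2 => ->; auto.
have {}IH : \sum_(j <- r) f j = k * 4 + ((size r)%:Z - 1 + \prod_(j <- r) f j) by rewrite -IH; ring.
rewrite IH; apply/dvdzP.
by case: IH2 => ->; case: (f1 i) => ->; [exists k|exists k|exists k|exists (k - 1)]; ring.
Qed.

(** The nonzero cubes are the roots of X^(2m) - 1, each attained three times; evaluate at -k, the
    degree being even. *)
Lemma prod_cube_add k : \prod_(v : 'F_p) (v ^+ 3 + k) = k * (k ^+ m.*2 - 1) ^+ 3.
Proof.
rewrite (bigD1 0) //= expr0n add0r; congr (_ * _).
rewrite big_gen double_n3.
have prim3 : m.*2.-primitive_root (g ^+ 3).
  have := exp_prim_root g_prim 3; rewrite double_n3 (gcdn_idPl _) ?dvdn_mulr //.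
  by rewrite mulKn.
have per j : (g ^+ (j + m.*2)) ^+ 3 = (g ^+ j) ^+ 3.
  by rewrite -!exprM mulnDl exprD [(m.*2 * 3)%N]mulnC -double_n3 (prim_expr_order g_prim) mulr1.
transitivity ((\prod_(j < m.*2) ((g ^+ j) ^+ 3 + k)) ^+ 3).
  rewrite (_ : 3 * m.*2 = m.*2 + (m.*2 + m.*2))%N; last by lia.
  rewrite !big_split_ord /= !exprS mulr1; do 2?congr (_ * _); apply: eq_bigr => j _ //.
    by rewrite [(m.*2 + _)%N]addnC per.
  by rewrite [(m.*2 + _)%N]addnC per [(m.*2 + _)%N]addnC per.
congr (_ ^+ 3); have := factor_Xn_sub_1 prim3 => /(congr1 (fun q => q.[- k])).
rewrite big_mkord horner_prod hornerD hornerN hornerXn hornerC => e.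
have sgn : (-1) ^+ m.*2 = 1 :> 'F_p by rewrite -signr_odd odd_double.
rewrite exprNn sgn mul1r in e; rewrite -e.
rewrite -[LHS]mul1r -{1}sgn -{1}(card_ord m.*2) -prodr_const -big_split /=.
by apply: eq_bigr => j _; rewrite !hornerD hornerN hornerX hornerC -!exprM mulnC; ring.
Qed.


Section Shift.

Variable k : 'F_p.
Hypothesis k_sq : chi k = 1.
Hypothesis k_noncube : k ^+ m.*2 != 1.

Lemma noncube_shift v : v ^+ 3 + k != 0.
Proof.
apply: contra k_noncube; rewrite addr_eq0 => /eqP e.
have k0 : k != 0 by apply/eqP => k0; move: k_sq; rewrite k0 chi0.
have v0 : v != 0.
  by apply: contra k0 => /eqP v0; move: e; rewrite v0 expr0n => /eqP; rewrite eq_sym oppr_eq0.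
have : (v ^+ 3) ^+ m.*2 = 1 by rewrite -exprM -double_n3 fermatFp.
by rewrite e exprNn -signr_odd odd_double mul1r => ->.
Qed.

Lemma cubic_sum_mod4 : (S k = p%:Z - 1 + chi (k ^+ m.*2 - 1) %[mod 4])%Z.
Proof.
rewrite /S sum_mod4; last by move=> v; apply: chi_pm1; apply: noncube_shift.
rewrite -chi_prod prod_cube_add chiM k_sq mul1r chiX3.
by rewrite -sum1_size sum1_card card_Fp.
Qed.

End Shift.





Lemma sum_exprFp k : (0 < k)%N ->
  \sum_(v : 'F_p) v ^+ k = if (n.*2 %| k)%N then -1 else 0.
Proof.
move=> k0; rewrite (bigD1 0) //= expr0n gtn_eqF // add0r big_gen.
under eq_bigr => j _ do rewrite -exprM mulnC exprM.
case: ifP => [|nk].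
  rewrite (prim_order_dvd g_prim) => /eqP ->.
  under eq_bigr => j _ do rewrite expr1n.
  rewrite sumr_const card_ord; apply/eqP; rewrite -subr_eq0 opprK natr1.
  by rewrite -p_odd natrFp_eq0.
have gk : g ^+ k - 1 != 0 by rewrite subr_eq0 -(prim_order_dvd g_prim) nk.
apply: (mulfI gk); rewrite -subrX1 mulr0 -exprM mulnC exprM (prim_expr_order g_prim).
by rewrite expr1n subrr.
Qed.

(** In (c + v^3)^n the sum over v keeps only exponents 3 j that are positive multiples of p - 1 =
    6m; as j <= 3m, this forces j = 2m. *)
Lemma cubic_sum_Fp c : (S c)%:~R = - ('C(n, m.*2)%:R * c ^+ m) :> 'F_p.
Proof.
rewrite /S rmorph_sum /=; under eq_bigr => v _ do rewrite chi_eq addrC exprDn.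
rewrite exchange_big /=.
have mn : (m.*2 < n.+1)%N by rewrite n_3m; lia.
rewrite (bigD1 (Ordinal mn)) //= [X in _ + X]big1 => [|j jm].
  under eq_bigr => v _ do rewrite -exprM -double_n3.
  rewrite addr0 -[RHS]mulrN1.
  have := @sum_exprFp n.*2; rewrite dvdnn double_gt0 n_gt0 => /(_ isT) <-.
  rewrite mulr_sumr; apply: eq_bigr => v _.
  have -> : (n - m.*2 = m)%N by rewrite n_3m; lia.
  by ring.
under eq_bigr => v _ do rewrite -mulrnAl -exprM.
rewrite -mulr_sumr; case: (posnP j) => [->|j0].
  under eq_bigr => v _ do rewrite muln0 expr0.
  by rewrite sumr_const card_Fp // (eqP (_ : p%:R == 0 :> 'F_p)) ?natrFp_eq0 // mulr0.
rewrite sum_exprFp ?muln_gt0 // double_n3 dvdn_pmul2l //.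
case: ifP => [/dvdnP[q qE]|]; last by rewrite mulr0.
have jn := ltn_ord j; move: jm; rewrite -val_eqE /=.
have q1 : q = 1%N by move: jn j0; rewrite qE n_3m; nia.
by rewrite qE q1 mul1n eqxx.
Qed.

Lemma theta_sq : (1 + 2%:R * w) ^+ 2 = - 3%:R.
Proof.
transitivity (4%:R * (w ^+ 2 + w + 1) - 3%:R); first by ring.
by rewrite cube_root_eq; ring.
Qed.

(** -3 is the square of 1 + 2w. *)
Lemma chi3 : chi 3%:R = (-1) ^+ n.
Proof.
have t0 : 1 + 2%:R * w != 0.
  by apply/eqP => t0; have := theta_sq; rewrite t0 expr0n => /eqP; rewrite eq_sym oppr_eq0 (negbTE three_neq0).
have := chiX2 t0; rewrite theta_sq -mulN1r chiM chiN1.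
by case: (chi_cases 3%:R) => [|[|]] ->; rewrite -signr_odd; case: (odd n).
Qed.

(* The values of [cubic_sum] at 1, g^2 and g^4 are 2A, 3B - A and -3B - A.  The
   residue of 3B - A modulo 4 is read off the product of the p terms of that sum, all
   of which are +1 or -1. *)
Lemma cubic_sum_rep : exists A B : int,
  [/\ S 1 = 2 * A, p%:Z = A ^+ 2 + 3 * B ^+ 2,
      A%:~R + (1 + 2%:R * w) * B%:~R = 0 :> 'F_p &
      (3 * B - A = p%:Z - 1 + chi (1 - w) %[mod 4])%Z].
Proof.
have lin := cubic_sum_linear; have sq := cubic_sum_square.
have w0 := cube_root_neq0.
have w2 : w ^+ 2 = - w - 1.
  by apply/eqP; rewrite -subr_eq0 -cube_root_eq; apply/eqP; ring.
have k2 : (g ^+ 2) ^+ m.*2 = w ^+ 2 by rewrite -!exprM mulnC.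
have k4 : (g ^+ 4) ^+ m.*2 = w.
  have -> : (g ^+ 4) ^+ m.*2 = w * w ^+ 3 by rewrite -exprS -!exprM mulnC.
  by rewrite -exprM mulnC -double_n3 (prim_expr_order g_prim) mulr1.
have g2 : chi (g ^+ 2) = 1 by rewrite chiX2 ?gen_neq0.
have g4 : chi (g ^+ 4) = 1 by rewrite (exprM g 2 2) chiX2 ?expf_neq0 ?gen_neq0.
have w1 : w != 1 by have := @gen_pow_neq1 1 isT; rewrite mul1n.
have w21 : w ^+ 2 != 1 by have := @gen_pow_neq1 2 isT; rewrite mulnC exprM.
have b4 : (T 2 = p%:Z - 1 + chi (1 - w) %[mod 4])%Z.
  rewrite cubic_sum_mod4 ?k2 //; congr (modz (_ + _) _).
  have -> : w ^+ 2 - 1 = (1 - w) * w ^+ 2.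
    transitivity ((1 - w) * w ^+ 2 + (w - 1) * (w ^+ 2 + w + 1)); first by ring.
    by rewrite cube_root_eq mulr0 addr0.
  by rewrite chiM chiX2 // mulr1.
have c4 : (T 4 = p%:Z - 1 + chi (w - 1) %[mod 4])%Z by rewrite cubic_sum_mod4 ?k4.
have e1 : chi (1 - w) = 1 \/ chi (1 - w) = -1 by apply: chi_pm1; rewrite subr_eq0 eq_sym.
have e2 : chi (w - 1) = 1 \/ chi (w - 1) = -1 by apply: chi_pm1; rewrite subr_eq0.
have F0 := cubic_sum_Fp (g ^+ 0); have F2 := cubic_sum_Fp (g ^+ 2); have F4 := cubic_sum_Fp (g ^+ 4).
have wm k : (g ^+ k.*2) ^+ m = w ^+ k by rewrite -!exprM -!mul2n -!mulnA [(k * m)%N]mulnC.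
rewrite (wm 0%N) in F0; rewrite (wm 1%N) in F2; rewrite (wm 2%N) in F4.
have ST0 : S 1 = T 0 by rewrite expr0.
rewrite ST0; move: (T 0) (T 2) (T 4) lin sq b4 c4 F0 F2 F4 => a b c lin sq b4 c4 F0 F2 F4.
(* Divisibility by 3 is read off the square, 2 (b^2 + c^2) - (b + c)^2 with b + c = -a; divisibility
   by 2 holds because b and c are odd by [b4] and [c4]. *)
have [D DE] : exists D, b - c = 6 * D.
  have sqD : (b - c) ^+ 2 = 3 * (4 * p%:Z - a ^+ 2).
    have aE : a = - b - c by move: lin; clear; lia.
    by rewrite mulrBr; have -> : 3 * (4 * p%:Z) = 2 * (6 * p%:Z); [ring | rewrite -sq aE; ring].
  have d3 : (3 %| b - c)%Z.
    have : (3 %| (b - c) ^+ 2)%Z by rewrite sqD dvdz_mulr.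
    by rewrite !dvdzE abszX Euclid_dvdX // andbT.
  rewrite pZ in b4 c4; have [r rE] := odd_of_mod4 e1 b4; have [s sE] := odd_of_mod4 e2 c4.
  have /dvdzP[q qE] := d3; exists (q %/ 2)%Z.
  by rewrite qE; move: qE; rewrite rE sE; clear; lia.
have [A AE] : exists A, a = 2 * A.
  rewrite pZ in b4 c4; have [r rE] := odd_of_mod4 e1 b4; have [s sE] := odd_of_mod4 e2 c4.
  by exists (- r - s - 1); move: lin; rewrite rE sE; clear; lia.
have bE : b = 3 * D - A by move: lin DE AE; clear; lia.
have cE : c = - 3 * D - A by move: lin DE AE; clear; lia.
exists A, D; split => //.
- by apply: (mulfI (_ : 6 != 0)) => //; rewrite -sq AE bE cE; ring.
- have p6 := six_neq0.
  have eA : (2%:R * A%:~R : 'F_p) = - 'C(n, m.*2)%:R.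
    by move: F0; rewrite AE rmorphM /= expr0 mulr1.
  (* By [cubic_sum_Fp], b - c is -C(n, 2m) (w - w^2), and w - w^2 = 1 + 2w. *)
  have eD : (6%:R * D%:~R : 'F_p) = (1 + 2%:R * w) * (2%:R * A%:~R).
    rewrite eA; have : (b - c)%:~R = 6%:R * D%:~R :> 'F_p by rewrite DE rmorphM.
    by rewrite rmorphB /= F2 F4 w2 expr1 => <-; ring.
  apply: (mulfI p6); rewrite mulr0 mulrDr mulrCA eD mulrA -expr2 theta_sq; ring.
- by rewrite -bE.
Qed.

(** Inverting a moves the roots to 0, 1 and -w, an equilateral triangle with centre q = (1 - w)/3;
    in the coordinate z = q (1 + v) the cubic is q^3 (v^3 + 1). The sign is chi(q) = chi(3) chi(1 -
    w). *)
Lemma legendre_cubic_sum :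
  \sum_a chi a * chi (1 - a) * chi (1 + w * a) = (-1) ^+ n * chi (1 - w) * S 1.
Proof.
have w0 := cube_root_neq0; have n3 := three_neq0.
pose q := (1 - w) / 3%:R.
have q0 : q != 0 by rewrite mulf_neq0 ?invr_eq0 // -oppr_eq0 opprB cube_root_neq1.
have w2 : w ^+ 2 = - w - 1.
  by apply/eqP; rewrite -subr_eq0 -cube_root_eq; apply/eqP; ring.
transitivity (\sum_(z : 'F_p) chi (z * (z - 1) * (z + w))).
  rewrite (bigD1 0) //= chi0 !mul0r add0r [RHS](bigD1 0) //= !mul0r chi0 add0r.
  rewrite [RHS](reindex_inj invr_inj) /=; apply: eq_big => [a|a a0].
    by rewrite invr_eq0.
  have -> : a^-1 * (a^-1 - 1) * (a^-1 + w) = (a^-1 ^+ 2) ^+ 2 * (a * (1 - a) * (1 + w * a)) by field.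
  by rewrite chiM chiX2 ?expf_neq0 ?invr_eq0 // mul1r !chiM.
have inj : injective (fun v : 'F_p => q * (1 + v)) by move=> u v /(mulfI q0) /addrI.
rewrite (reindex_inj inj) /=.
have -> : (-1) ^+ n * chi (1 - w) = chi q.
  have -> : q = (1 - w) * 3%:R / 3%:R ^+ 2 by rewrite expr2 invfM mulrA mulfK.
  by rewrite !chiM -exprVn chiX2 ?invr_eq0 // mulr1 chi3 mulrC.
rewrite /S mulr_sumr; apply: eq_bigr => v _.
rewrite -(chiX3 q) -chiM; congr chi.
have qE : 1 - w = 3%:R * q by rewrite mulrCA mulfV // mulr1.
have wE : w = 1 - 3%:R * q by rewrite -qE; ring.
have : 3%:R * (3%:R * q ^+ 2 - 3%:R * q + 1) = 0.
  by rewrite -[RHS]cube_root_eq [in RHS]wE; ring.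
move/eqP; rewrite mulf_eq0 (negbTE n3) /= => /eqP qq.
rewrite wE.
transitivity (q ^+ 3 * (v ^+ 3 + 1) + q * (1 + v) * (-1) * (3%:R * q ^+ 2 - 3%:R * q + 1)); last first.
  by rewrite qq mulr0 addr0.
ring.
Qed.

(** (1 + i)^2 = 2i for i^2 = -1, so 2 and i = g^(n/2) have the same character. *)
Lemma chi_two : ~~ odd n -> chi 2%:R = (-1) ^+ n./2.
Proof.
move=> n_even; pose i := g ^+ n./2; have nE : n = n./2.*2 by rewrite even_halfK.
have i2 : i ^+ 2 = -1 by rewrite -exprM muln2 -nE gen_expn.
have i0 : i != 0 by rewrite expf_neq0 ?gen_neq0.
have i1 : 1 + i != 0.
  apply: contra neg1_neq1 => /eqP e; have iE : i = -1 by rewrite -[LHS](addKr 1) e addr0.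
  by rewrite -i2 iE sqrrN expr1n.
have : chi (2%:R * i) = 1 by rewrite -(chiX2 i1) sqrrD i2; congr chi; ring.
rewrite chiM /i => e; have chig k : chi (g ^+ k) = (-1) ^+ k.
  by elim: k => [|k IH]; rewrite ?expr0 ?chi1 // !exprS chiM chi_gen IH.
move: e; rewrite chig -signr_odd; case: (odd _); rewrite ?expr1 ?expr0 ?mulrN1 ?mulr1 // => e.
by rewrite -[LHS]opprK e.
Qed.

Lemma chi_squareP a : (exists b : 'F_p, b ^+ 2 = a) <-> (chi a = 0 \/ chi a = 1).
Proof.
split=> [[b <-]|].
  by case: (eqVneq b 0) => [->|b0]; [left; rewrite expr0n chi0 | right; rewrite chiX2].
rewrite /chi; case: eqP => [->|/eqP a0]; first by exists 0; rewrite expr0n.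
case: eqP => [an|_]; last by case.
have /(prim_rootP g_prim) [i aE] : a ^+ n.*2 = 1 by apply: fermatFp.
move=> _; exists (g ^+ i./2); rewrite -exprM muln2 aE.
suff ie : ~~ odd i by rewrite even_halfK.
move: an; rewrite aE -exprM mulnC exprM gen_expn -signr_odd.
by case: (odd i) => //= /eqP; rewrite (negbTE neg1_neq1).
Qed.

End Generator.

End CharacterSums.

(** * The value and derivative of P_n at the square root of -3 *)

Section Lift.

Variables (R : comUnitRingType) (p n m : nat).
Hypothesis p_prime : prime p.
Hypothesis p_odd : p = n.*2.+1.
Hypothesis n_3m : n = (3 * m)%N.
Hypothesis p_sq0 : p%:R * p%:R = 0 :> R.

Lemma intr_unit (z : int) : z%:~R != 0 :> 'F_p -> z%:~R \is a @GRing.unit R.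
Proof.
have cop k : ~~ (p %| k)%N -> k%:R \is a @GRing.unit R.
  by move=> pk; apply: (coprime_natr_unit p_prime p_sq0); rewrite coprime_sym prime_coprime.
rewrite (intrFp_eq0 p_prime); case: z => k; first by rewrite dvdzE -pmulrn => /cop.
by rewrite NegzE dvdzE abszN mulrNz unitrN -pmulrn => /cop.
Qed.

Lemma intr_expp (i j : int) : i%:~R = j%:~R :> 'F_p -> i%:~R ^+ p = j%:~R ^+ p :> R.
Proof.
move=> /eqP; rewrite -subr_eq0 -rmorphB /= (intrFp_eq0 p_prime) => /dvdzP[k kE].
have -> : i = j + p%:Z * k by rewrite [_ * k]mulrC -kE; ring.
rewrite rmorphD rmorphM /= -pmulrn p_odd (exprD_sq0 _ _ _ _) -p_odd //.
by rewrite -!mulrA mulrA p_sq0 mul0r addr0.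
Qed.

Lemma exprFp_p (a : 'F_p) : a ^+ p = a.
Proof. by have := expf_card a; rewrite card_Fp. Qed.

(** Modulo p^2 a single p-th power already removes the dependence on the lift ([intr_expp]). *)
Definition teich (a : 'F_p) : R := (nat_of_ord a)%:R ^+ p.

Lemma teich_intr (z : int) : teich z%:~R = z%:~R ^+ p.
Proof.
rewrite /teich pmulrn; apply: intr_expp; rewrite -pmulrn.
exact: natr_Zp.
Qed.

Lemma teich_lift (a : 'F_p) : exists2 z : int, z%:~R = a & teich a = z%:~R.
Proof.
exists ((nat_of_ord a)%:Z ^+ p); last by rewrite rmorphXn /= -pmulrn.
by rewrite rmorphXn /= -pmulrn natr_Zp exprFp_p.
Qed.

Lemma teichE (a : 'F_p) (z : int) : z%:~R = a -> teich a = z%:~R ^+ p.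
Proof. by move=> <-; apply: teich_intr. Qed.

Lemma teichM : {morph teich : a b / a * b}.
Proof.
move=> a b; have [z zE tz] := teich_lift a; have [w wE tw] := teich_lift b.
rewrite (@teichE (a * b) (z * w)) ?rmorphM /= ?zE ?wE // exprMn.
by rewrite -(teichE zE) -(teichE wE).
Qed.

Lemma teich1 : teich 1 = 1.
Proof. by rewrite (@teichE 1 1) // expr1n. Qed.

Lemma teichX a k : teich (a ^+ k) = teich a ^+ k.
Proof. by elim: k => [|k IH]; rewrite ?expr0 ?teich1 // !exprS teichM IH. Qed.

Lemma teich_expp a : teich a ^+ p = teich a.
Proof. by rewrite -teichX exprFp_p. Qed.

Lemma teich_expn a : teich a ^+ n = (chi n a)%:~R.
Proof.
rewrite -teichX -(chi_eq p_prime p_odd n_3m) teich_intr.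
have sgn : (-1) ^+ p = -1 :> R by rewrite -signr_odd p_odd /= odd_double.
case: (chi_cases n a) => [|[|]] ->; rewrite ?expr1n //; first by rewrite expr0n p_odd.
Qed.

(** The reason for the exponent p n in [tau_legendre_sum]: the n-th power of the right side is
    exactly chi(1 - a). *)
Lemma one_sub_teich a : (1 - teich a) ^+ p = teich (1 - a).
Proof.
have [z zE ->] := teich_lift a.
by rewrite (@teichE (1 - a) (1 - z)) ?rmorphB /= ?zE.
Qed.

Lemma one_add_teich a b : (1 + teich a * teich b) ^+ p = teich (1 + a * b).
Proof.
have [z zE ->] := teich_lift a; have [w wE ->] := teich_lift b.
by rewrite (@teichE _ (1 + z * w)) ?rmorphD ?rmorphM /= ?zE ?wE.
Qed.

Lemma teich_sub1_unit a : a != 1 -> teich a - 1 \is a GRing.unit.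
Proof.
move=> a1; have [z zE ->] := teich_lift a.
have -> : z%:~R - 1 = (z - 1)%:~R :> R by rewrite rmorphB.
by apply: intr_unit; rewrite rmorphB /= zE subr_eq0.
Qed.

Variable g : 'F_p.
Hypothesis g_prim : n.*2.-primitive_root g.

Lemma teich_sum k : \sum_(a | a != 0) teich a ^+ k = if (n.*2 %| k)%N then n.*2%:R else 0.
Proof.
rewrite (big_gen p_prime p_odd n_3m g_prim).
under eq_bigr => j _ do rewrite -teichX -exprM mulnC exprM teichX.
case: ifP => [|nk].
  rewrite (prim_order_dvd g_prim) => /eqP ->; rewrite teich1.
  under eq_bigr => j _ do rewrite expr1n.
  by rewrite sumr_const card_ord.
have gk : g ^+ k != 1 by rewrite -(prim_order_dvd g_prim) nk.
apply: (mulrI (teich_sub1_unit gk)); rewrite -subrX1 mulr0 -teichX -exprM mulnC exprM.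
by rewrite (prim_expr_order g_prim) expr1n teich1 subrr.
Qed.

Local Notation w := (g ^+ m.*2).
Local Notation omega := (teich w).
Local Notation t := (- omega).
Local Notation H := (hpoly R n).[t].
Local Notation D := (hpoly R n)^`().[t].
Local Notation eta := (chi n (1 - w)).

Lemma omega_eq : omega ^+ 2 + omega + 1 = 0.
Proof.
have w1 : w != 1 by rewrite -subr_eq0 (cube_root_neq1 p_prime p_odd n_3m g_prim).
apply: (mulrI (teich_sub1_unit w1)); rewrite mulr0; transitivity (omega ^+ 3 - 1); first by ring.
have -> : omega ^+ 3 = 1; last by rewrite subrr.
by rewrite -teichX -exprM mulnC -(double_n3 n_3m) (prim_expr_order g_prim) teich1.
Qed.

Lemma t_sq : t ^+ 2 = t - 1.
Proof. by rewrite -[RHS]addr0 -omega_eq; ring. Qed.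

Lemma teich_legendre_sum :
  \sum_(a | a != 0) teich a ^+ n * (1 - teich a) ^+ (p * n) * (1 - t * teich a) ^+ (p * n) =
  ((-1) ^+ n * eta * cubic_sum n (1 : 'F_p))%:~R.
Proof.
rewrite -(legendre_cubic_sum p_prime p_odd n_3m g_prim) [in RHS](bigD1 0) //= chi0 !mul0r add0r.
rewrite rmorph_sum /=; apply: eq_bigr => a _.
rewrite !exprM one_sub_teich mulNr opprK one_add_teich !teich_expn.
by rewrite !rmorphM.
Qed.

Local Notation theta := (1 + 2 * omega).

Lemma theta_sqR : theta ^+ 2 = - 3.
Proof.
transitivity (4 * (omega ^+ 2 + omega + 1) - 3); first by ring.
by rewrite omega_eq; ring.
Qed.

Lemma lt5_natr_unit k : (0 < k < 5)%N -> k%:R \is a @GRing.unit R.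
Proof.
move=> k5; apply: (small_natr_unit p_prime p_sq0); have := n_gt0 p_prime p_odd.
by move=> n0; rewrite p_odd n_3m; lia.
Qed.

Lemma theta_unit : theta \is a GRing.unit.
Proof.
have : theta ^+ 2 \is a GRing.unit by rewrite theta_sqR unitrN; apply: (@lt5_natr_unit 3).
by rewrite unitrX_pos.
Qed.

(** * The unit root modulo p^2 in terms of A and B *)

Section Representation.

Variables A B : int.
Hypothesis sumA : cubic_sum n (1 : 'F_p) = 2 * A.
Hypothesis p_AB : p%:Z = A ^+ 2 + 3 * B ^+ 2.
Hypothesis A_B : A%:~R + (1 + 2%:R * w) * B%:~R = 0 :> 'F_p.
Hypothesis p_neq0 : p%:R != 0 :> R.

Lemma hpoly_quadratic : H ^+ 2 + p%:R = - (2 * eta * A)%:~R * H.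
Proof.
have := tau_legendre_fix p_prime p_odd p_sq0 (A := [pred a | a != 0])
   (fun a _ => teich_expp a) teich_sum n_3m t_sq.
rewrite teich_legendre_sum sumA => <-; congr (_ * _).
have -> : (-1) ^+ n.+1 = ((-1) ^+ n.+1)%:~R :> R by rewrite rmorphXn /= mulrNz.
rewrite -rmorphM -rmorphN; congr _%:~R.
by rewrite exprS -signr_odd; case: (odd n); rewrite ?expr1 ?expr0; ring.
Qed.

(** Selects the unit root: [hpoly_quadratic] alone would allow H to vanish modulo p. *)
Lemma p_hpoly : p%:R * H = - p%:R * (2 * eta * A)%:~R.
Proof.
have t1 : t ^+ n.*2 = 1 by rewrite -[n.*2]muln2 exprM (sixth_root_expn n_3m t_sq) sqrr_sign.
have := tau_legendre_sum p_prime p_odd p_sq0 (A := [pred a | a != 0])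
   (fun a _ => teich_expp a) teich_sum t1.
rewrite teich_legendre_sum sumA (gpoly_fix p_prime p_odd n_3m t_sq) => e.
have eN : (-1) ^+ n = ((-1) ^+ n)%:~R :> R by rewrite rmorphXn /= mulrNz.
have s2 : (-1) ^+ n * (-1) ^+ n = 1 :> R by rewrite -expr2 sqrr_sign.
have n2E : n.*2%:R = p%:R - 1 :> R by rewrite p_odd -natr1; ring.
have e2 : (-1) ^+ n * ((-1) ^+ n * eta * (2 * A))%:~R = (2 * eta * A)%:~R :> R.
  rewrite eN -rmorphM; congr _%:~R.
  by rewrite -signr_odd; case: (odd n); rewrite ?expr1 ?expr0; ring.
rewrite -e2 e n2E; set W := \sum_(_ < _) _.
transitivity (- (((-1) ^+ n * (-1) ^+ n) * (- p%:R * H + (p%:R * p%:R) * (H - 2 * W)))).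
  by rewrite s2 p_sq0; ring.
by ring.
Qed.

Lemma eta_sq : eta * eta = 1.
Proof.
apply: chi_neq0_sq.
by rewrite -oppr_eq0 opprB (cube_root_neq1 p_prime p_odd n_3m g_prim).
Qed.

(** If one of A, B vanishes modulo p, so does the other, and then p^2 divides p. *)
Lemma rep_neq0 : A%:~R != 0 :> 'F_p /\ B%:~R != 0 :> 'F_p.
Proof.
have three := three_neq0 p_prime p_odd n_3m.
have pF : (A%:~R : 'F_p) ^+ 2 + 3%:R * B%:~R ^+ 2 = 0.
  have := congr1 (fun z : int => z%:~R : 'F_p) p_AB.
  rewrite rmorphD rmorphM !rmorphXn /= => <-.
  by apply/eqP; rewrite -pmulrn (natrFp_eq0 p_prime).
have AB0 : ~ (A%:~R = 0 :> 'F_p /\ B%:~R = 0 :> 'F_p).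
  move=> [/eqP A0 /eqP B0]; move: A0 B0; rewrite !(intrFp_eq0 p_prime).
  move=> /dvdzP[a aE] /dvdzP[b bE]; move: p_AB; rewrite aE bE => e.
  have /eqP : p%:Z * (p%:Z * (a ^+ 2 + 3 * b ^+ 2)) = p%:Z * 1 by rewrite mulr1 [RHS]e; ring.
  have p0 : p%:Z != 0 by have := prime_gt0 p_prime; case: (p).
  rewrite (inj_eq (mulfI p0)) => /eqP /(congr1 (fun z => p%:Z %| z)%Z).
  rewrite dvdz_mulr // => /esym; rewrite dvdzE dvdn1 /= => /eqP p1.
  by have := prime_gt1 p_prime; rewrite p1.
split; apply/eqP => e; apply: AB0; split=> //; move: pF; rewrite e expr0n /=.
  by rewrite add0r => /eqP; rewrite mulf_eq0 (negbTE three) sqrf_eq0 => /eqP.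
by rewrite mulr0 addr0 => /eqP; rewrite sqrf_eq0 => /eqP.
Qed.

(** R is abstract and [intr_unit] recognizes units only among images of integers. *)
Lemma hpoly_int : exists z : int, H = z%:~R.
Proof.
have [z _ zE] := teich_lift w.
exists (\sum_(j < n.+1) (-1) ^+ j * 'C(n, j)%:Z * 'C(n + j, j)%:Z * (- z) ^+ j).
rewrite (horner_wide _ (size_hpoly R n)) rmorph_sum /=; apply: eq_bigr => j _.
by rewrite coef_hpoly /hcoef zE !rmorphM !rmorphXn /= !rmorphN /= -!pmulrn.
Qed.

Lemma hpoly_unit : H \is a GRing.unit.
Proof.
have [z zE] := hpoly_int; rewrite zE; apply: intr_unit.
have [A0 _] := rep_neq0.
have pz : p%:R * (z + 2 * eta * A)%:~R = 0 :> R.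
  by rewrite rmorphD /= -zE mulrDr p_hpoly; ring.
have : (z + 2 * eta * A)%:~R = 0 :> 'F_p.
  apply/eqP; apply: contraT => /intr_unit u.
  by case/negP: p_neq0; apply/eqP; apply: (mulIr u); rewrite pz mul0r.
rewrite rmorphD /= => /eqP; rewrite addr_eq0 => /eqP ->; rewrite oppr_eq0 !rmorphM /=.
rewrite !mulf_neq0 //.
  by apply: small_natrFp => //; have := n_gt0 p_prime p_odd; rewrite p_odd; lia.
apply/eqP => e0; have := congr1 (fun z : int => z%:~R : 'F_p) eta_sq.
by rewrite rmorphM /= e0 mul0r => /eqP; rewrite eq_sym oner_eq0.
Qed.

Lemma rep_nilpotent : exists k : int,
  A%:~R + theta * B%:~R = p%:R * k%:~R :> R.
Proof.
have [z zw zE] := teich_lift w.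
have : (A + (1 + 2 * z) * B)%:~R = 0 :> 'F_p.
  by rewrite -A_B -zw !(rmorphD, rmorphM).
move/eqP; rewrite (intrFp_eq0 p_prime) => /dvdzP[k kE]; exists k.
transitivity ((A + (1 + 2 * z) * B)%:~R : R).
  by rewrite zE !(rmorphD, rmorphM).
by rewrite kE rmorphM /= -pmulrn mulrC.
Qed.

Lemma p_AB_R : p%:R = A%:~R ^+ 2 + 3 * B%:~R ^+ 2 :> R.
Proof.
have := congr1 (fun z : int => z%:~R : R) p_AB.
by rewrite rmorphD rmorphM !rmorphXn.
Qed.

Lemma hpoly_deriv_eq : 2 * theta * D * H = H ^+ 2 - p%:R.
Proof. by rewrite -(deriv_hpoly_fix p_prime p_odd p_sq0 n_3m t_sq); ring. Qed.

Lemma hpoly_sum_val : 2 * H - 2 * theta * D = - (2 * eta * A)%:~R.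
Proof.
apply: (mulIr hpoly_unit); rewrite -hpoly_quadratic mulrBl hpoly_deriv_eq; ring.
Qed.

(** p = (A + theta B)(A - theta B) = q (2A - q), and q is a multiple of p. *)
Lemma p_nilpotent q : q = A%:~R + theta * B%:~R :> R -> q * q = 0 /\ p%:R = 2 * A%:~R * q.
Proof.
move=> qE; have [k kE] := rep_nilpotent.
have qq : q * q = 0.
  rewrite qE kE; transitivity (p%:R * p%:R * k%:~R ^+ 2 : R); first by ring.
  by rewrite p_sq0 mul0r.
split=> //; rewrite p_AB_R -[LHS]addr0 -qq.
rewrite qE; transitivity (2 * A%:~R ^+ 2 + 2 * A%:~R * (theta * B%:~R) + (3 + theta ^+ 2) * B%:~R ^+ 2).
  by ring.
by rewrite theta_sqR; ring.
Qed.

(** Putting A = q - theta B into [hpoly_quadratic] produces -2 eta q H = 4 A q = 2p, exactly the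
    change from + p to - p. *)
Lemma hpoly_quadratic_diff : H ^+ 2 - p%:R = 2 * theta * (eta * B)%:~R * H.
Proof.
have [k kE] := rep_nilpotent; have [qq pE] := p_nilpotent erefl.
set q := A%:~R + _ in kE qq pE.
have qH : q * H = - (2 * eta * A)%:~R * q.
  rewrite kE mulrAC p_hpoly; ring.
have -> : H ^+ 2 - p%:R = H ^+ 2 + p%:R - 2 * p%:R by ring.
have AE : A%:~R = q - theta * B%:~R by rewrite /q; ring.
have e2 : eta%:~R * eta%:~R = 1 :> R by rewrite -rmorphM /= eta_sq.
rewrite hpoly_quadratic !rmorphM /= {1}AE.
transitivity (- 2 * eta%:~R * (q * H) + 2 * theta * (eta%:~R * B%:~R) * H - 2 * p%:R : R).
  by ring.
rewrite qH !rmorphM /= pE.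
transitivity (4 * (eta%:~R * eta%:~R - 1) * A%:~R * q + 2 * theta * (eta%:~R * B%:~R) * H : R).
  by ring.
by rewrite e2; ring.
Qed.

Lemma deriv_hpoly_val : D = (eta * B)%:~R.
Proof.
have u2 : 2 \is a @GRing.unit R := @lt5_natr_unit 2 isT.
apply: (mulIr hpoly_unit); apply: (mulrI theta_unit); apply: (mulrI u2).
by rewrite !mulrA hpoly_deriv_eq hpoly_quadratic_diff; ring.
Qed.

(** Denominator-free form of 2H = theta (4 b - p/(3b)) with b = eta B, the shape of 4y - p/(3y). *)
Lemma hpoly_val : 6 * (eta * B)%:~R * H = theta * (12 * (eta * B)%:~R ^+ 2 - p%:R).
Proof.
have u2 : 2 \is a @GRing.unit R := @lt5_natr_unit 2 isT.
have [qq pE] := p_nilpotent erefl; set q := A%:~R + _ in qq pE.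
have HE : H = theta * (eta * B)%:~R - (eta * A)%:~R.
  apply: (mulrI u2); have := hpoly_sum_val; rewrite deriv_hpoly_val => e.
  transitivity (2 * H - 2 * theta * (eta * B)%:~R + 2 * theta * (eta * B)%:~R); first by ring.
  by rewrite e !rmorphM /=; ring.
have e2 : eta%:~R * eta%:~R = 1 :> R by rewrite -rmorphM /= eta_sq.
have AE : A%:~R = q - theta * B%:~R by rewrite /q; ring.
have pB : theta * p%:R = 6 * B%:~R * q.
  rewrite pE {1}AE; transitivity (2 * theta * (q * q) - 2 * theta ^+ 2 * B%:~R * q); first by ring.
  by rewrite qq theta_sqR; ring.
rewrite HE (mulrBr theta) pB !rmorphM /=.
transitivity (6 * (eta%:~R * eta%:~R) * (theta * B%:~R ^+ 2 - A%:~R * B%:~R) : R); first by ring.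
rewrite AE; transitivity (6 * (eta%:~R * eta%:~R) * (2 * theta * B%:~R ^+ 2 - B%:~R * q) : R); first by ring.
transitivity (12 * theta * (eta%:~R * eta%:~R) * B%:~R ^+ 2 - 6 * (eta%:~R * eta%:~R) * (B%:~R * q) : R).
  by ring.
transitivity (12 * theta * (eta%:~R * eta%:~R) * B%:~R ^+ 2 - 6 * B%:~R * q : R).
  by rewrite e2; ring.
by ring.
Qed.

End Representation.

End Lift.

(** * Signs, and passage from rationals to residues modulo p^2 *)

(** By Brahmagupta's identity p^2 = (x a + 3 y c)^2 + 3 (x c - y a)^2 when c^2 = b^2; if p divides x
    c - y a, that number is 0, since otherwise the last term is at least 3 p^2. *)
Lemma quadratic_form_unique (p : nat) (x y a b : int) : prime p ->
  p%:Z = x ^+ 2 + 3 * y ^+ 2 -> p%:Z = a ^+ 2 + 3 * b ^+ 2 ->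
  x ^+ 2 = a ^+ 2 /\ y ^+ 2 = b ^+ 2.
Proof.
move=> p_prime pxy pab.
have p0 : (0 < p%:Z)%R by rewrite ltz_nat prime_gt0.
have main (c : int) : c ^+ 2 = b ^+ 2 -> (p%:Z %| x * c - y * a)%Z -> x * c = y * a.
  move=> cb /dvdzP[q qE].
  have e : p%:Z ^+ 2 = (x * a + 3 * y * c) ^+ 2 + 3 * (x * c - y * a) ^+ 2.
    by rewrite expr2 {1}pxy pab -cb; ring.
  have q0 : q = 0.
    have le : 3 * q ^+ 2 * p%:Z ^+ 2 <= 1 * p%:Z ^+ 2.
      rewrite mul1r [leRHS]e qE -subr_ge0.
      by rewrite (_ : _ - _ = (x * a + 3 * y * c) ^+ 2) ?sqr_ge0 //; ring.
    move: le; rewrite ler_pM2r ?exprn_gt0 // => le.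
    apply/eqP; apply: contraLR le => q0; rewrite -ltNge.
    have : 0 < q ^+ 2 by rewrite exprn_even_gt0.
    by move: (q ^+ 2); clear; lia.
  by apply/eqP; rewrite -subr_eq0 qE q0 mul0r.
suff [c cb xc] : exists2 c, c ^+ 2 = b ^+ 2 & x * c = y * a.
  have yb : y ^+ 2 = b ^+ 2.
    have : p%:Z * (b ^+ 2 - y ^+ 2) = 0.
      transitivity ((x * c) ^+ 2 - (y * a) ^+ 2).
        by rewrite mulrBr {1}pxy pab !exprMn cb; ring.
      by rewrite xc subrr.
    by move/eqP; rewrite mulf_eq0 gt_eqF //= subr_eq0 => /eqP.
  by split=> //; apply: (addIr (3 * y ^+ 2)); rewrite -pxy yb.
have : (p%:Z %| (x * b - y * a) * (x * b + y * a))%Z.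
  apply/dvdzP; exists (b ^+ 2 - y ^+ 2).
  transitivity ((x ^+ 2 + 3 * y ^+ 2) * b ^+ 2 - y ^+ 2 * (a ^+ 2 + 3 * b ^+ 2)); first by ring.
  by rewrite -pxy -pab; ring.
rewrite dvdzE abszM Euclid_dvdM // => /orP[] d.
  by exists b => //; apply: main.
exists (- b); first by rewrite sqrrN.
apply: main; first by rewrite sqrrN.
by rewrite mulrN -opprD dvdzE abszN.
Qed.

Lemma sqr_mod2 (b : int) : exists s : int, b ^+ 2 = b + 2 * s.
Proof.
have [r [] bE] : exists r : int, b = 2 * r \/ b = 2 * r + 1 by exists (b %/ 2)%Z; lia.
  by exists (2 * r ^+ 2 - r); rewrite bE; ring.
by exists (2 * r ^+ 2 + r); rewrite bE; ring.
Qed.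

Lemma sqr_mod8 (x : int) : (x = 1 %[mod 4])%Z -> exists s : int, x ^+ 2 = 8 * s + 1.
Proof.
move=> x1; have [r xE] : exists r : int, x = 4 * r + 1 by exists (x %/ 4)%Z; lia.
by exists (2 * r ^+ 2 + r); rewrite xE; ring.
Qed.

Lemma even_of_sqr (b k : int) : b ^+ 2 = 2 * k -> exists c : int, b = 2 * c.
Proof. by move=> bk; have [s bs] := sqr_mod2 b; exists (k - s); lia. Qed.

(** With B = 2b, the equation for p gives e = b modulo 2, and the condition modulo 4 reads eta = 2b
    - A. *)
Lemma even_sign (A B e x eta : int) : (eta = 1 \/ eta = -1) ->
  4 * e + 1 = A ^+ 2 + 3 * B ^+ 2 -> (3 * B - A = 4 * e + 1 - 1 + eta %[mod 4])%Z ->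
  x ^+ 2 = A ^+ 2 -> (x = 1 %[mod 4])%Z ->
  - (eta * A) = (if (e %% 2)%Z == 0 then 1 else -1) * x.
Proof.
move=> eta1 pAB modAB xA x1; have [s sE] := sqr_mod8 x1.
have [b bE] : exists b : int, B = 2 * b.
  apply: (@even_of_sqr _ (2 * e - 4 * s - B ^+ 2)); move: pAB; rewrite -xA sE.
  by move: (B ^+ 2); clear; lia.
have [c cE] := sqr_mod2 b.
have [d eE] : exists d : int, e = b + 2 * d.
  exists (s + b + 3 * c); move: pAB; rewrite -xA sE bE exprMn cE; clear; lia.
have xA' : x = A \/ x = - A.
  by move/eqP: xA; rewrite eqf_sqr => /orP[] /eqP; [left | right].
move: eE modAB eta1 xA' x1; rewrite bE; clear -b d => eE0 modAB.
have [f bf] : exists f : int, b = 2 * f \/ b = 2 * f + 1 by exists (b %/ 2)%Z; lia.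
by case: eqP => e0; case=> eE; case=> xE x1; rewrite eE0 eE in e0 modAB *; case: bf modAB e0 => -> *; lia.
Qed.

(** With A = 2a, the equation for p gives e = a modulo 2, and the condition modulo 4 reads eta = 2a
    + 2 - B. *)
Lemma odd_sign (A B e y eta : int) : (eta = 1 \/ eta = -1) ->
  4 * e + 3 = A ^+ 2 + 3 * B ^+ 2 -> (3 * B - A = 4 * e + 3 - 1 + eta %[mod 4])%Z ->
  y ^+ 2 = B ^+ 2 -> (y = 1 %[mod 4])%Z ->
  eta * B = (if (e %% 2)%Z == 0 then 1 else -1) * y.
Proof.
move=> eta1 pAB modAB yB y1; have [s sE] := sqr_mod8 y1.
have [a aE] : exists a : int, A = 2 * a.
  apply: (@even_of_sqr _ (2 * e - 12 * s)); move: pAB; rewrite -yB sE.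
  by move: (A ^+ 2); clear; lia.
have [c cE] := sqr_mod2 a.
have [d eE] : exists d : int, e = a + 2 * d.
  exists (3 * s + c); move: pAB; rewrite -yB sE aE exprMn cE; clear; lia.
have yB' : y = B \/ y = - B.
  by move/eqP: yB; rewrite eqf_sqr => /orP[] /eqP; [left | right].
move: eE modAB eta1 yB' y1; rewrite aE; clear -a d => eE0 modAB.
have [f bf] : exists f : int, a = 2 * f \/ a = 2 * f + 1 by exists (a %/ 2)%Z; lia.
by case: eqP => e0; case=> eE; case=> yE y1; rewrite eE0 eE in e0 modAB *; case: bf modAB e0 => -> *; lia.
Qed.

(** * Images of p-integral rationals modulo p^2 *)

Section Reduction.

Variables (R : comUnitRingType) (p : nat).
Hypothesis p_prime : prime p.
Hypothesis R_char : forall z : int, (z%:~R == 0 :> R) = ((p%:Z ^+ 2) %| z)%Z.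

Let p_sq0 : p%:R * p%:R = 0 :> R.
Proof. by apply/eqP; rewrite -expr2 -natrX pmulrn R_char -rmorphXn dvdzz. Qed.

Lemma coprimez_unit (v : int) : coprimez v p%:Z -> v%:~R \is a @GRing.unit R.
Proof.
rewrite coprimezE => cop; case: v cop => k /= cop.
  by rewrite -pmulrn (coprime_natr_unit p_prime p_sq0).
by rewrite NegzE mulrNz unitrN -pmulrn (coprime_natr_unit p_prime p_sq0).
Qed.

Lemma coprimez_neq0 (v : int) : coprimez v p%:Z -> v%:~R != 0 :> rat.
Proof.
move=> cop; rewrite intr_eq0; apply: contraL cop => /eqP ->.
by rewrite coprimezE /= /coprime gcd0n; case: (p) p_prime => [|[]].
Qed.

(* [reduces r x]: the rational r is p-integral and x is its image in R. *)
Definition reduces (r : rat) (x : R) : Prop := exists u v : int,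
  [/\ coprimez v p%:Z, r = u%:~R / v%:~R & x * v%:~R = u%:~R].

Lemma reduces_int (z : int) : reduces z%:~R z%:~R.
Proof. by exists z, 1; rewrite coprimezE /= coprime1n divr1 mulr1. Qed.

Lemma reduces_nat (k : nat) : reduces k%:R k%:R.
Proof. exact: (reduces_int k). Qed.

Lemma reducesV (v : int) : coprimez v p%:Z -> reduces v%:~R^-1 v%:~R^-1.
Proof.
move=> cop; exists 1, v; split=> //; first by rewrite mul1r.
by rewrite mulVr // coprimez_unit.
Qed.

Lemma reducesM r s x y : reduces r x -> reduces s y -> reduces (r * s) (x * y).
Proof.
move=> [u [v [cv -> xE]]] [u' [v' [cv' -> yE]]]; exists (u * u'), (v * v'); split.
- by rewrite coprimezMl cv.
- by rewrite !rmorphM /= invfM mulrACA.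
- by rewrite !rmorphM /= -xE -yE mulrACA.
Qed.

Lemma reducesD r s x y : reduces r x -> reduces s y -> reduces (r + s) (x + y).
Proof.
move=> [u [v [cv -> xE]]] [u' [v' [cv' -> yE]]].
exists (u * v' + u' * v), (v * v'); split.
- by rewrite coprimezMl cv.
- have [v0 v'0] := (coprimez_neq0 cv, coprimez_neq0 cv').
  by rewrite !(rmorphD, rmorphM) /= addf_div.
- by rewrite !(rmorphD, rmorphM) /= -xE -yE; ring.
Qed.

Lemma reducesN r x : reduces r x -> reduces (- r) (- x).
Proof.
by move=> h; rewrite -mulN1r -[- x]mulN1r; apply: reducesM => //; apply: (reduces_int (-1)).
Qed.

Lemma reduces_sum n (f : nat -> rat) (F : nat -> R) :
  (forall k, (k < n)%N -> reduces (f k) (F k)) ->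
  reduces (\sum_(0 <= k < n) f k) (\sum_(0 <= k < n) F k).
Proof.
elim: n => [|n IH] h; first by rewrite !big_geq //; apply: (reduces_int 0).
rewrite !big_nat_recr //=; apply: reducesD; last exact: h.
by apply: IH => k kn; apply: h; apply: ltnW.
Qed.

Lemma reduces_eqmod r s x : reduces r x -> reduces s x -> eqmod_psq p r s.
Proof.
move=> rx sx; have := reducesD rx (reducesN sx); rewrite subrr.
move=> [u [v [cv rsE]]]; rewrite mul0r => /esym /eqP; rewrite R_char => /dvdzP[q qE].
exists (q%:~R / v%:~R); last first.
  by rewrite rsE qE rmorphM rmorphXn /= -pmulrn; ring.
have v0 := coprimez_neq0 cv.
rewrite /Zloc unfold_in; set c := q%:~R / v%:~R.
have e : numq c * v = q * denq c.
  apply/eqP; rewrite -(eqr_int rat) !rmorphM /=; apply/eqP.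
  have dc : (denq c)%:~R != 0 :> rat by rewrite intr_eq0 denq_neq0.
  have : c * (denq c)%:~R * v%:~R = q%:~R * (denq c)%:~R by rewrite /c mulrAC divfK.
  by rewrite -{1}[c]divq_num_den divfK.
(* [Zloc] tests the reduced denominator, which divides every other one. *)
have dv : (denq c %| v)%Z.
  rewrite -(@Gauss_dvdzr _ (numq c)) ?e ?dvdz_mull // coprimezE coprime_sym.
  exact: coprime_num_den.
by apply: coprimez_dvdl dv cv.
Qed.

End Reduction.

Lemma legendre3 (k : nat) : legendre k%:Z 3 =
  if (k %% 3 == 0)%N then 0 else if (k %% 3 == 1)%N then 1 else -1.
Proof.
rewrite /legendre dvdzE /= /dvdn; case: eqP => // k0.
have k3 : (k %% 3 < 3)%N by rewrite ltn_pmod.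
have sqE (t : 'I_3) : ((nat_of_ord t)%:Z ^+ 2 == k%:Z %[mod 3%:Z])%Z = (t ^ 2 == k %[mod 3])%N.
  have -> : (nat_of_ord t)%:Z ^+ 2 = (t ^ 2)%N%:Z by rewrite -mulnn PoszM expr2.
  by rewrite !modz_nat.
case: ifP => [/existsP[t]|/existsP h].
  rewrite sqE => /eqP e; have -> // : (k %% 3 == 1)%N.
  rewrite -e; case: t e => [[|[|[|t]]] ?] //= e.
  by case: k0; rewrite -e.
case: eqP => // k1; case: h; exists (@Ordinal 3 1 isT).
by rewrite sqE k1.
Qed.

(** * The sums of the theorem as values of H and H' *)

Section Sums.

Variables (R : comUnitRingType) (p n m : nat).
Hypothesis p_prime : prime p.
Hypothesis p_odd : p = n.*2.+1.
Hypothesis n_3m : n = (3 * m)%N.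
Hypothesis R_char : forall z : int, (z%:~R == 0 :> R) = ((p%:Z ^+ 2) %| z)%Z.

Let p_sq0 : p%:R * p%:R = 0 :> R.
Proof. by apply/eqP; rewrite -expr2 -natrX pmulrn R_char -rmorphXn dvdzz. Qed.

(** The term ratios agree up to p^2: with 2n = p - 1, (2n - 2k)(2n + 2k + 2) = p^2 - (2k + 1)^2. *)
Lemma hcoef_central k : (k < p)%N -> 16 ^+ k * hcoef R n k = 'C(2 * k, k)%:R ^+ 2.
Proof.
elim: k => [|k IH] kp; first by rewrite /hcoef !bin0; ring.
have u : k.+1%:R \is a @GRing.unit R by apply: (small_natr_unit p_prime p_sq0).
have {}IH := IH (ltnW kp).
have binE : (k.+1 * 'C(2 * k.+1, k.+1) = 2 * (2 * k + 1) * 'C(2 * k, k))%N.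
  have e1 := mul_bin_diag (2 * k.+1) k; have e2 := mul_bin_diag (2 * k + 1) k.
  have e3 : ('C((2 * k.+1).-1, k) = 'C(2 * k + 1, k.+1))%N.
    have -> : ((2 * k.+1).-1 = 2 * k + 1)%N by lia.
    by rewrite -[RHS]bin_sub; [congr binomial; lia | lia].
  rewrite addn1 /= -addn1 in e2; rewrite e3 in e1.
  apply/eqP; rewrite -(eqn_pmul2l (ltn0Sn k)); apply/eqP.
  by rewrite -e1; transitivity (2 * k.+1 * (k.+1 * 'C(2 * k + 1, k.+1)))%N; [lia | rewrite -e2; lia].
apply: (mulrI u); apply: (mulrI u).
transitivity ((k.+1%:R * 'C(2 * k.+1, k.+1)%:R) ^+ 2 : R); last by ring.
rewrite -natrM binE.
transitivity (16 ^+ k * (-1) ^+ k.+1 * 16 * (k.+1%:R * 'C(n, k.+1)%:R) * (k.+1%:R * 'C(n + k.+1, k.+1)%:R) : R).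
  by rewrite /hcoef exprS; ring.
rewrite bin_step bin_step2.
transitivity (- 4 * ((2 * n%:R - 2 * k%:R) * (2 * n%:R + 2 * k%:R + 2)) * (16 ^+ k * hcoef R n k) : R).
  by rewrite /hcoef exprS; ring.
have -> : 2 * n%:R = p%:R - 1 :> R by rewrite p_odd -(natr1 n.*2) -mul2n natrM; ring.
rewrite IH.
transitivity ((4 * (2 * k%:R + 1) ^+ 2 - 4 * (p%:R * p%:R)) * 'C(2 * k, k)%:R ^+ 2 : R); first by ring.
by rewrite p_sq0; ring.
Qed.

Lemma reduces_summand k : (k < p)%N ->
  reduces p ('C(2 * k, k)%:R ^+ 2 / (- 16) ^+ k) ((-1) ^+ k * hcoef R n k).
Proof.
move=> kp; exists ('C(2 * k, k)%:Z ^+ 2), ((-16) ^+ k); split.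
- rewrite coprimezXl // coprimezE /= coprime_sym prime_coprime //.
  have -> : 16%N = (2 ^ 4)%N by [].
  by rewrite Euclid_dvdX // andbT gtnNdvd //; have := n_gt0 p_prime p_odd; rewrite p_odd; lia.
- by rewrite !rmorphXn /= rmorphN.
- rewrite !rmorphXn /= rmorphN /= -pmulrn -hcoef_central // mulrAC -exprMn mulrNN mul1r.
  by rewrite mulrC.
Qed.

Lemma hpoly_bigop x : \sum_(0 <= k < p) hcoef R n k * x ^+ k = (hpoly R n).[x].
Proof.
rewrite big_mkord (@horner_coef_wide _ p); first by apply: eq_bigr => k _; rewrite coef_hpoly.
by apply: leq_trans (size_hpoly R n) _; rewrite p_odd; lia.
Qed.

Lemma deriv_hpoly_bigop x :
  \sum_(0 <= k < p) k%:R * hcoef R n k * x ^+ k = x * (hpoly R n)^`().[x].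
Proof.
have -> : x * (hpoly R n)^`().[x] = ('X * (hpoly R n)^`()).[x] by rewrite hornerM hornerX.
rewrite big_mkord (@horner_coef_wide _ p).
  by apply: eq_bigr => k _; rewrite coefXD coef_hpoly.
apply/leq_sizeP => j pj; rewrite coefXD nth_default ?mulr0 //.
by apply: leq_trans (size_hpoly R n) _; move: pj; rewrite p_odd; lia.
Qed.

Section Omega.

Variable omega : R.
Hypothesis omega_eq : omega ^+ 2 + omega + 1 = 0.

Let omega3 : omega ^+ 3 = 1.
Proof.
transitivity ((omega ^+ 2 + omega + 1) * (omega - 1) + 1); first by ring.
by rewrite omega_eq; ring.
Qed.

Let omega_mod k : omega ^+ k = omega ^+ (k %% 3).
Proof. by rewrite {1}(divn_eq k 3) exprD mulnC exprM omega3 expr1n mul1r. Qed.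

Let omega_sq : omega ^+ 2 = - omega - 1.
Proof. by rewrite -[RHS]addr0 -omega_eq; ring. Qed.

(** Gauss sum expansion of the character modulo 3, with 1 + 2 omega = omega - omega^2. *)
Lemma legendre3_omega k :
  (1 + 2 * omega) * (legendre k%:Z 3)%:~R = omega ^+ k - (omega ^+ 2) ^+ k.
Proof.
rewrite legendre3 -exprM mulnC exprM (omega_mod k).
have : (k %% 3 < 3)%N by rewrite ltn_pmod.
case: (k %% 3)%N => [|[|[|//]]] _ /=.
- by rewrite !expr0 expr1n; ring.
- by rewrite !expr1 omega_sq; ring.
rewrite mulrNz mulr1z -exprM (omega_mod (2 * 2)) /= expr1 omega_sq; ring.
Qed.

Lemma mod3_omega k : 3 * (3 %| k)%N%:R - 1 = omega ^+ k + (omega ^+ 2) ^+ k.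
Proof.
rewrite /dvdn -exprM mulnC exprM (omega_mod k).
have : (k %% 3 < 3)%N by rewrite ltn_pmod.
case: (k %% 3)%N => [|[|[|//]]] _ /=.
- by rewrite !expr0 expr1n; ring.
- by rewrite !expr1 omega_sq; ring.
rewrite -exprM (omega_mod (2 * 2)) /= expr1 omega_sq; ring.
Qed.

Local Notation t := (- omega).
Local Notation H := (hpoly R n).[t].
Local Notation D := (hpoly R n)^`().[t].

Let t_sq : t ^+ 2 = t - 1.
Proof. by rewrite sqrrN omega_sq. Qed.

Let uE : - omega ^+ 2 = 1 - t.
Proof. by rewrite omega_sq; ring. Qed.

Lemma sum_legendre3 :
  (1 + 2 * omega) * (\sum_(0 <= k < p) (legendre k%:Z 3)%:~R * ((-1) ^+ k * hcoef R n k)) =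
  H - (-1) ^+ n * H.
Proof.
rewrite -(hpoly_inv p_prime p_odd n_3m t_sq) -uE -!hpoly_bigop -sumrB mulr_sumr.
apply: eq_bigr => k _; rewrite (mulrA (1 + 2 * omega)) legendre3_omega.
by rewrite (exprNn omega) (exprNn (omega ^+ 2)); ring.
Qed.

Lemma sum_legendre3_mul :
  (1 + 2 * omega) * (\sum_(0 <= k < p) (legendre k%:Z 3)%:~R * (k%:R * ((-1) ^+ k * hcoef R n k))) =
  t * D + (-1) ^+ n * ((1 - t) * D).
Proof.
transitivity (t * D - (1 - t) * (hpoly R n)^`().[1 - t]); last first.
  by rewrite (deriv_hpoly_inv p_prime p_odd n_3m t_sq); ring.
rewrite -uE -!deriv_hpoly_bigop -sumrB mulr_sumr.
apply: eq_bigr => k _; rewrite (mulrA (1 + 2 * omega)) legendre3_omega.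
by rewrite (exprNn omega) (exprNn (omega ^+ 2)); ring.
Qed.

Lemma sum_mod3_mul :
  \sum_(0 <= k < p) (3 * (3 %| k)%N%:R - 1) * (k%:R * ((-1) ^+ k * hcoef R n k)) =
  t * D - (-1) ^+ n * ((1 - t) * D).
Proof.
transitivity (t * D + (1 - t) * (hpoly R n)^`().[1 - t]); last first.
  by rewrite (deriv_hpoly_inv p_prime p_odd n_3m t_sq); ring.
rewrite -uE -!deriv_hpoly_bigop -big_split /=.
apply: eq_bigr => k _; rewrite mod3_omega.
by rewrite (exprNn omega) (exprNn (omega ^+ 2)); ring.
Qed.

Lemma sum_mod3 :
  \sum_(0 <= k < p) (3 * (3 %| k)%N%:R - 1) * ((-1) ^+ k * hcoef R n k) =
  H + (-1) ^+ n * H.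
Proof.
rewrite -(hpoly_inv p_prime p_odd n_3m t_sq) -uE -!hpoly_bigop -big_split /=.
apply: eq_bigr => k _; rewrite mod3_omega.
by rewrite (exprNn omega) (exprNn (omega ^+ 2)); ring.
Qed.

End Omega.

End Sums.

Lemma intr_Zp_eq0 (q : nat) (z : int) : (1 < q)%N ->
  (z%:~R == 0 :> 'Z_q) = (q%:Z %| z)%Z.
Proof.
move=> q1; have nat0 k : (k%:R == 0 :> 'Z_q) = (q %| k)%N.
  by rewrite -val_eqE /= val_Zp_nat.
case: z => k; first by rewrite -pmulrn nat0 dvdzE.
by rewrite NegzE mulrNz oppr_eq0 -pmulrn nat0 dvdzE.
Qed.

Lemma legendre_chi (p n m : nat) (g : 'F_p) (a : int) : prime p -> p = n.*2.+1 ->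
  n = (3 * m)%N -> n.*2.-primitive_root g -> legendre a p = chi n (a%:~R : 'F_p).
Proof.
move=> p_prime p_odd n_3m g_prim; rewrite /legendre -(intrFp_eq0 p_prime).
case: eqP => [->|/eqP a0]; first by rewrite chi0.
have sqP := chi_squareP p_prime p_odd n_3m g_prim a%:~R.
have castE (t : nat) : ((t%:Z ^+ 2 == a %[mod p%:Z])%Z) = (t%:R ^+ 2 == a%:~R :> 'F_p).
  rewrite eqz_mod_dvd -(intrFp_eq0 p_prime) rmorphB rmorphXn /= -pmulrn.
  by rewrite subr_eq0.
case: ifP => [/existsP[t]|/existsP h].
  rewrite castE => /eqP e; have [] : chi n (a%:~R : 'F_p) = 0 \/ chi n (a%:~R : 'F_p) = 1.
  - by apply/sqP; exists (nat_of_ord t)%:R.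
  - by rewrite /chi (negbTE a0); case: ifP.
  - by [].
case: (chi_pm1 n a0) => // e1; case: h.
have [b bE] : exists b : 'F_p, b ^+ 2 = a%:~R by apply/sqP; right.
have bp : (b < p)%N by have := ltn_ord b; rewrite [X in (_ < X)%N](Fp_cast p_prime).
by exists (Ordinal bp); rewrite castE /= natr_Zp bE.
Qed.

Lemma sign_modz (e : nat) : (if (e%:Z %% 2)%Z == 0 then 1 else -1 : int) = (-1) ^+ e.
Proof.
rewrite -signr_odd modz_nat -[0]/(Posz 0) eqz_nat modn2.
by case: (odd e).
Qed.

Theorem theorem1p2 (p : nat) (x y : int)
    (p_prime : prime p) (p_mod3 : p = 1 %[mod 3])
    (p_eq : p%:Z = x ^+ 2 + 3 * y ^+ 2) :
  ((p%:Z = x %[mod 4])%Z -> (x = 1 %[mod 4])%Z ->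
    eqmod_psq p
      ((legendre 2 p)%:~R * (2 * x%:~R))
      (\sum_(0 <= k < p)
         (3 * (3 %| k)%:R - 1) * (2 * k%:R + 1) *
         ('C(2 * k, k)%:R ^+ 2 / (- 16) ^+ k)))
  /\
  ((- p%:Z = y %[mod 4])%Z -> (y = 1 %[mod 4])%Z ->
    [/\ eqmod_psq p
          (\sum_(0 <= k < p)
             (legendre k%:Z 3)%:~R * ('C(2 * k, k)%:R ^+ 2 / (- 16) ^+ k))
          ((- 1) ^+ ((p - 3) %/ 4)%N * (4 * y%:~R - p%:R / (3 * y%:~R))),
        eqmod_psq p
          (\sum_(0 <= k < p)
             (legendre k%:Z 3)%:~R *
             (k%:R * 'C(2 * k, k)%:R ^+ 2 / (- 16) ^+ k))
          ((- 1) ^+ ((p + 1) %/ 4)%N * y%:~R)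
      & eqmod_psq p
          ((- 1) ^+ ((p + 1) %/ 4)%N * y%:~R)
          (\sum_(0 <= k < p)
             (1 - 3 * (3 %| k)%:R) *
             (k%:R * 'C(2 * k, k)%:R ^+ 2 / (- 16) ^+ k))]).
Proof.
have p_gt1 := prime_gt1 p_prime.
have [n p_odd] : exists n, p = n.*2.+1.
  exists p./2; have := odd_double_half p; have [p2|->] := even_prime p_prime; last by lia.
  by move: p_mod3; rewrite p2.
have [m n_3m] : exists m, n = (3 * m)%N.
  by exists (n %/ 3)%N; move: p_mod3; rewrite p_odd; clear; lia.
have [g g_prim] := primitive_exists p_prime p_odd n_3m.
have [A [B [sumA p_AB A_B mod4]]] := cubic_sum_rep p_prime p_odd n_3m g_prim.
have [xA yB] := quadratic_form_unique p_prime p_eq p_AB.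
have sq_gt1 : (1 < p ^ 2)%N by rewrite (ltn_exp2l 0 2).
have [R R_char] : exists R : comUnitRingType,
    forall z : int, (z%:~R == 0 :> R) = (p%:Z ^+ 2 %| z)%Z.
  exists 'Z_(p ^ 2) => z; have sqE : (p ^ 2)%N%:Z = p%:Z ^+ 2 by rewrite -mulnn PoszM expr2.
  by rewrite (intr_Zp_eq0 _ sq_gt1) sqE.
have p_sq0 : p%:R * p%:R = 0 :> R.
  by apply/eqP; rewrite -expr2 -natrX pmulrn R_char -rmorphXn dvdzz.
have p_neq0 : p%:R != 0 :> R.
  rewrite pmulrn R_char dvdzE abszX /= gtnNdvd ?prime_gt0 //.
  by rewrite -{1}(expn1 p) ltn_exp2l.
set w := g ^+ m.*2 in A_B mod4; set eta := chi n (1 - w) in mod4.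
have eta1 : eta = 1 \/ eta = -1.
  by apply: chi_pm1; rewrite -oppr_eq0 opprB (cube_root_neq1 p_prime p_odd n_3m g_prim).
pose omega := teich R w.
have omega_eq : omega ^+ 2 + omega + 1 = 0 by apply: (omega_eq p_prime p_odd n_3m p_sq0 g_prim).
pose H := (hpoly R n).[- omega]; pose D := (hpoly R n)^`().[- omega].
have sumE := hpoly_sum_val p_prime p_odd n_3m p_sq0 g_prim sumA p_AB p_neq0.
have derivE := deriv_hpoly_val p_prime p_odd n_3m p_sq0 g_prim sumA p_AB A_B p_neq0.
have valE := hpoly_val p_prime p_odd n_3m p_sq0 g_prim sumA p_AB A_B p_neq0.
rewrite -/w -/eta -/omega -/H -/D in sumE derivE valE.
have sumR := reduces_summand p_prime p_odd n_3m R_char.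
have redH := reduces_int R p.
have redk k : reduces p k%:R (k%:R : R) by apply: reduces_nat.
have leg3 k : reduces p (legendre k%:Z 3)%:~R ((legendre k%:Z 3)%:~R : R) by apply: redH.
have mod3R k : reduces p (3 * (3 %| k)%:R - 1) (3 * (3 %| k)%N%:R - 1 : R).
  by apply: (reducesD p_prime); [apply: reducesM; apply: redk | apply: (redH (-1))].
have kR k : (k < p)%N ->
    reduces p (k%:R * 'C(2 * k, k)%:R ^+ 2 / (- 16) ^+ k) (k%:R * ((-1) ^+ k * hcoef R n k)).
  by move=> kp; rewrite -mulrA; apply: reducesM => //; apply: sumR.
have s0 := sum_mod3 p_prime p_odd n_3m omega_eq.
have s1 := sum_mod3_mul p_prime p_odd n_3m omega_eq.
have l0 := sum_legendre3 p_prime p_odd n_3m omega_eq.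
have l1 := sum_legendre3_mul p_prime p_odd n_3m omega_eq.
rewrite -/H -/D in s0 s1 l0 l1.
split=> [px x1 | py y1].
  have [e nE] : exists e, n = e.*2.
    by exists n./2; move: px x1; rewrite p_odd; clear; lia.
  have sgn : (-1) ^+ n = 1 :> R by rewrite nE -signr_odd odd_double.
  have etaA : - (eta * A) = (-1) ^+ e * x.
    rewrite (@even_sign A B e x eta) //.
    - by rewrite sign_modz.
    - by rewrite -p_AB p_odd nE; lia.
    - by rewrite mod4 p_odd nE; congr (modz _ _); lia.
  have leg2 : legendre 2 p = (-1) ^+ e.
    rewrite (legendre_chi 2 p_prime p_odd n_3m g_prim).
    rewrite (chi_two p_prime p_odd n_3m g_prim) nE ?odd_double //.
    by rewrite doubleK.
  apply: (reduces_eqmod p_prime R_char (x := (legendre 2 p * (2 * x))%:~R)).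
    by have := redH (legendre 2 p * (2 * x)); rewrite !rmorphM.
  have -> : (legendre 2 p * (2 * x))%:~R = \sum_(0 <= k < p)
      (3 * (3 %| k)%N%:R - 1) * (2 * k%:R + 1) * ((-1) ^+ k * hcoef R n k) :> R.
    (* For even n the two sums are -(1 + 2 omega) D and 2H, which together form the left side of
       [sumE]. *)
    transitivity (2 * (\sum_(0 <= k < p) (3 * (3 %| k)%N%:R - 1) * (k%:R * ((-1) ^+ k * hcoef R n k)))
      + \sum_(0 <= k < p) (3 * (3 %| k)%N%:R - 1) * ((-1) ^+ k * hcoef R n k) : R).
      rewrite s0 s1 sgn; transitivity (2 * H - 2 * (1 + 2 * omega) * D); last by ring.
      rewrite sumE leg2; have -> : (-1) ^+ e * (2 * x) = - (2 * eta * A).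
        by rewrite mulrCA -etaA; ring.
      by rewrite rmorphN.
    by rewrite mulr_sumr -big_split /=; apply: eq_bigr => k _; ring.
  apply: (reduces_sum p_prime) => k kp; apply: reducesM; last exact: sumR.
  apply: reducesM; first exact: mod3R.
  by apply: (reducesD p_prime); [apply: reducesM; apply: redk | apply: (redH 1)].
have [e nE] : exists e, n = e.*2.+1.
  by exists n./2; move: py y1; rewrite p_odd; clear; lia.
have sgn : (-1) ^+ n = -1 :> R by rewrite nE -signr_odd /= odd_double.
have p3 : ((p - 3) %/ 4)%N = e by rewrite p_odd nE; lia.
have p1 : ((p + 1) %/ 4)%N = e.+1 by rewrite p_odd nE; lia.
have etaB : eta * B = (-1) ^+ e * y.
  rewrite (@odd_sign A B e y eta) //.
  - by rewrite sign_modz.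
  - by rewrite -p_AB p_odd nE; lia.
  - by rewrite mod4 p_odd nE; congr (modz _ _); lia.
have thU := theta_unit p_prime p_odd n_3m p_sq0 g_prim.
rewrite -/omega in thU.
(* For odd n the right side of [l1] is (2t - 1) D = -(1 + 2 omega) D with t = -omega, so the factor
   cancels. *)
have sum1 : \sum_(0 <= k < p) (legendre k%:Z 3)%:~R * (k%:R * ((-1) ^+ k * hcoef R n k)) =
    ((-1) ^+ e.+1 * y)%:~R :> R.
  apply: (mulrI thU); rewrite l1 sgn exprS -mulrA -etaB rmorphM /= -derivE; ring.
have redY : reduces p ((-1) ^+ e.+1 * y%:~R) (((-1) ^+ e.+1 * y)%:~R : R).
  by have := redH ((-1) ^+ e.+1 * y); rewrite !rmorphM !rmorphXn /= rmorphN.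
rewrite p3 p1; split.
- have cop : coprimez (3 * y) p%:Z.
    (* Applied to the pair (x, y) itself: y is prime to p, so p/(3y) is p-integral. *)
    have [_ y0] := rep_neq0 p_prime p_odd n_3m p_eq.
    have three := three_neq0 p_prime p_odd n_3m.
    rewrite coprimezE coprime_sym prime_coprime // -[(p %| _)%N]/(p%:Z %| 3 * y)%Z.
    by rewrite -(intrFp_eq0 p_prime) rmorphM /= mulf_neq0.
  have u3y := coprimez_unit p_prime R_char cop.
  apply: (reduces_eqmod p_prime R_char (x := \sum_(0 <= k < p) (legendre k%:Z 3)%:~R * ((-1) ^+ k * hcoef R n k))).
    by apply: (reduces_sum p_prime) => k kp; apply: reducesM => //; apply: sumR.
  have -> : \sum_(0 <= k < p) (legendre k%:Z 3)%:~R * ((-1) ^+ k * hcoef R n k) =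
     ((-1) ^+ e)%:~R * (4 * y%:~R - p%:R / (3 * y)%:~R) :> R.
    (* The factor 3y creates 6 eta B H up to sign, the left side of [valE]. *)
    apply: (mulrI thU); apply: (mulrI u3y); rewrite l0 sgn.
    transitivity (((-1) ^+ e * (-1) ^+ e)%:~R * (3 * y)%:~R * (2 * H) : R).
      by rewrite -expr2 sqrr_sign; ring.
    transitivity (((-1) ^+ e)%:~R * (6 * ((-1) ^+ e * y)%:~R * H) : R).
      by rewrite !rmorphM /=; ring.
    rewrite -etaB valE etaB -[RHS]mulr1.
    have ee : ((-1) ^+ e)%:~R * ((-1) ^+ e)%:~R = 1 :> R by rewrite -rmorphM -expr2 sqrr_sign.
    set E := ((-1) ^+ e)%:~R in ee *; rewrite (rmorphM _ _ y) -/E.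
    transitivity (E * (1 + 2 * omega) * (12 * (E * E) * y%:~R ^+ 2 - p%:R * ((3 * y)%:~R / (3 * y)%:~R)) : R).
      by rewrite divrr //; ring.
    by rewrite ee rmorphM /=; ring.
  apply: reducesM; first by have := redH ((-1) ^+ e); rewrite !rmorphXn /= rmorphN.
  apply: (reducesD p_prime); first by apply: reducesM; [apply: redk | apply: redH].
  apply: reducesN; apply: reducesM; first exact: redk.
  by have := reducesV p_prime R_char cop; rewrite [X in reduces _ X^-1]rmorphM.
- apply: (reduces_eqmod p_prime R_char _ redY); rewrite -sum1.
  by apply: (reduces_sum p_prime) => k kp; apply: reducesM => //; apply: kR.
apply: (reduces_eqmod p_prime R_char redY); have -> : ((-1) ^+ e.+1 * y)%:~R =
   \sum_(0 <= k < p) (1 - 3 * (3 %| k)%N%:R) * (k%:R * ((-1) ^+ k * hcoef R n k)) :> R.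
  transitivity (- (\sum_(0 <= k < p) (3 * (3 %| k)%N%:R - 1) * (k%:R * ((-1) ^+ k * hcoef R n k))) : R).
    by rewrite s1 sgn exprS -mulrA -etaB rmorphM /= -derivE; ring.
  by rewrite -sumrN; apply: eq_bigr => k _; ring.
apply: (reduces_sum p_prime) => k kp; apply: reducesM; last exact: kR.
by rewrite -opprB -[X in reduces _ _ X]opprB; apply: reducesN.
Qed.
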